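(* Let $a_0,a_1,b_0,b_1,c_0,c_1,d_0,d_1,e_0,e_1,z_0,z_1$ be non-negative integers such that for $i=0,1$: $b_i+c_i=e_i+z_i$, $a_i+b_i=d_i+e_i$, $c_i+d_i=z_i+a_i$; put $a=a_0+a_1$, and similarly $b,c,d,e,z$. Let $\alpha\in\binom{[a]}{a_1}$, $\beta\in\binom{[b]}{b_1}$, $\gamma\in\binom{[c]}{c_1}$, $\delta\in\binom{[d]}{d_1}$, $\epsilon\in\binom{[e]}{e_1}$, $\zeta\in\binom{[z]}{z_1}$. If $\mathrm{sort}(\beta)=\mathrm{sort}(\zeta)$ (and hence also $\mathrm{sort}(\gamma)=\mathrm{sort}(\epsilon)$), then $$\mathrm{Hex}(\alpha,\beta,\gamma,\delta,\epsilon,\zeta)=\mathrm{Hex}(\alpha,\zeta,\gamma,\delta,\epsilon,\beta)=\mathrm{Hex}(\alpha,\beta,\epsilon,\delta,\gamma,\zeta)=\mathrm{Hex}(\alpha,\zeta,\epsilon,\delta,\gamma,\beta),$$ i.e. the pairs $\beta,\zeta$ and $\gamma,\epsilon$ can be commuted independently while preserving the number of hexagonal puzzles.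
   Context: Strings: $\binom{[n]}{k}$ denotes the set of binary strings (words in the symbols $0,1$) of length $n$ with exactly $k$ ones; $\mathrm{sort}(\lambda)=0^{n-k}1^k$ for $\lambda\in\binom{[n]}{k}$. Puzzles: work in the triangular lattice in the plane, whose unit edges make angles $0^\circ,60^\circ,120^\circ$ with the $x$-axis. Edge labels are the three symbols $0$, $1$, $10$ (where $10$ is a single symbol). A unit triangle (upward- or downward-pointing) with labeled edges is an allowed piece if its three labels read clockwise are $(0,0,0)$, $(1,1,1)$, or a cyclic rotation of $(1,0,10)$. Given a convex lattice polygon (sides along lattice directions, some sides possibly of length $0$) each of whose sides is labeled by a binary string, one symbol per unit edge, read clockwise around the polygon, a puzzle with this boundary is an assignment of labels to all unit lattice edges in the polygon which agrees with the prescribed labels on the boundary and for which every unit triangle in the polygon is an allowed piece. $\mathrm{Hex}(\alpha,\beta,\gamma,\delta,\epsilon,\zeta)$ is the number of puzzles on the convex hexagon (all angles $120^\circ$, some sides possibly of length $0$) whose sides, in clockwise order SW, NW, North, NE, SE, South, are labeled respectively $\alpha,\beta,\gamma,\delta,\epsilon,\zeta$, each read clockwise; the side lengths are the lengths of the strings. *)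

(* Defs.v *)
From HB Require Import structures.
From mathcomp Require Import all_boot.

Set Implicit Arguments.
Unset Strict Implicit.
Unset Printing Implicit Defensive.

(** A binary string is a [seq bool], with [false] for the symbol 0 and [true]
    for the symbol 1. *)
Definition strings (n k : nat) : {pred seq bool} :=
  [pred s : seq bool | (size s == n) && (count_mem true s == k)].

Definition sort01 (s : seq bool) : seq bool :=
  nseq (size s - count_mem true s) false ++ nseq (count_mem true s) true.

Variant label := L0 | L1 | L10.

Definition ord_of_label (l : label) : 'I_3 :=
  match l with
  | L0 => @Ordinal 3 0 isT
  | L1 => @Ordinal 3 1 isT
  | L10 => @Ordinal 3 2 isT
  end.

Definition label_of_ord (i : 'I_3) : label := nth L0 [:: L0; L1; L10] i.

Lemma ord_of_labelK : cancel ord_of_label label_of_ord.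
Proof. by case. Qed.

HB.instance Definition _ := Finite.copy label (can_type ord_of_labelK).

Definition label_of_bit (b : bool) : label := if b then L1 else L0.

(** The arguments are the labels of the sides of a unit triangle in clockwise
    order, starting from an arbitrary side. *)
Definition allowed (x y w : label) : bool :=
  (x, y, w) \in [:: (L0, L0, L0); (L1, L1, L1);
                    (L1, L0, L10); (L0, L10, L1); (L10, L1, L0)].

(** The pair [(x, y)] denotes the lattice point x u + y v, where u and v are the
    unit vectors at angles 0 and 60 degrees. *)
Definition point := (nat * nat)%type.

(** Directions 0, 60 and 120 degrees. *)
Variant dir := D0 | D60 | D120.

Definition ord_of_dir (k : dir) : 'I_3 :=
  match k with
  | D0 => @Ordinal 3 0 isT
  | D60 => @Ordinal 3 1 isT
  | D120 => @Ordinal 3 2 isT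
  end.

Definition dir_of_ord (i : 'I_3) : dir := nth D0 [:: D0; D60; D120] i.

Lemma ord_of_dirK : cancel ord_of_dir dir_of_ord.
Proof. by case. Qed.

HB.instance Definition _ := Finite.copy dir (can_type ord_of_dirK).

(** The upward unit triangle at (x, y) has vertices (x, y), (x+1, y), (x, y+1);
    [(k, (x, y))] is its side of direction k.  Every unit lattice edge is a side
    of exactly one upward triangle. *)
Definition edge := (dir * point)%type.

Definition edge_ends (g : edge) : point * point :=
  let: (k, (x, y)) := g in
  match k with
  | D0 => ((x, y), (x.+1, y))
  | D60 => ((x, y), (x, y.+1))
  | D120 => ((x.+1, y), (x, y.+1))
  end.

(** Clockwise, the hexagon with side lengths a, b, c, d, e, z (SW, NW, North,
    NE, SE, South) has the vertices
      (a, 0), (0, a), (0, a+b), (c, a+b), (c+d, a+b-d), (c+d, a+b-d-e)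
    and it closes up when a+b = d+e and c+d = z+a.  The first coordinate is
    bounded by the NW and SE sides, the second by the South and North sides, and
    the sum of the two by the SW and NE sides; the lower bounds 0 are implicit
    in [point]. *)
Definition in_hexagon (a b c d : nat) (p : point) : bool :=
  [&& p.1 <= c + d, p.2 <= a + b & a <= p.1 + p.2 <= a + b + c].

Definition hexagon_edges (a b c d : nat) : seq edge :=
  [seq g <- [seq (k, p) | k <- [:: D0; D60; D120],
                          p <- [seq (x, y) | x <- iota 0 (c + d).+1,
                                             y <- iota 0 (a + b).+1]]
     | in_hexagon a b c d (edge_ends g).1 && in_hexagon a b c d (edge_ends g).2].

(** The unit edges of the sides, in clockwise order. *)
Definition side_SW (a : nat) : seq edge :=
  mkseq (fun i => (D120, (a - i.+1, i))) a.
Definition side_NW (a b : nat) : seq edge :=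
  mkseq (fun i => (D60, (0, a + i))) b.
Definition side_N (a b c : nat) : seq edge :=
  mkseq (fun i => (D0, (i, a + b))) c.
Definition side_NE (a b c d : nat) : seq edge :=
  mkseq (fun i => (D120, (c + i, a + b - i.+1))) d.
Definition side_SE (c d e : nat) : seq edge :=
  mkseq (fun i => (D60, (c + d, e - i.+1))) e.
Definition side_S (c d z : nat) : seq edge :=
  mkseq (fun i => (D0, (c + d - i.+1, 0))) z.

Definition side_labeled (L : edge -> label) (s : seq edge) (w : seq bool) :=
  map L s == map label_of_bit w.

(** The upward triangle (x, y), (x+1, y), (x, y+1) has left, right and bottom
    sides of directions 60, 120 and 0; the downward triangle (x+1, y), (x, y+1),
    (x+1, y+1) has left, top and right sides of directions 120, 0 and 60. *)
Definition triangles_allowed (L : edge -> label) (a b c d : nat) : bool :=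
  [forall x : 'I_(c + d), forall y : 'I_(a + b),
    ([&& in_hexagon a b c d (x : nat, y : nat),
         in_hexagon a b c d (x.+1, y : nat) &
         in_hexagon a b c d (x : nat, y.+1)] ==>
       allowed (L (D60, (x : nat, y : nat)))
               (L (D120, (x : nat, y : nat)))
               (L (D0, (x : nat, y : nat))))
    &&
    ([&& in_hexagon a b c d (x.+1, y : nat),
         in_hexagon a b c d (x : nat, y.+1) &
         in_hexagon a b c d (x.+1, y.+1)] ==>
       allowed (L (D120, (x : nat, y : nat)))
               (L (D0, (x : nat, y.+1)))
               (L (D60, (x.+1, y : nat))))].

Definition is_puzzle (L : edge -> label)
    (alpha beta gamma delta epsilon zeta : seq bool) : bool :=
  let a := size alpha in let b := size beta in let c := size gamma in
  let d := size delta in let e := size epsilon in let z := size zeta in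
  [&& side_labeled L (side_SW a) alpha,
      side_labeled L (side_NW a b) beta,
      side_labeled L (side_N a b c) gamma,
      side_labeled L (side_NE a b c d) delta,
      side_labeled L (side_SE c d e) epsilon,
      side_labeled L (side_S c d z) zeta
    & triangles_allowed L a b c d].

(** A labeling of the edges in a list, as a function on all edges.  When the
    hexagon closes up, the default value is never used by [is_puzzle]. *)
Definition labeling_fun (s : seq edge) (f : {ffun seq_sub s -> label})
    (g : edge) : label :=
  if insub g is Some g' then f g' else L0.

(** Meaningful only when the side lengths close up (see [in_hexagon]). *)
Definition Hex (alpha beta gamma delta epsilon zeta : seq bool) : nat :=
  let E := hexagon_edges (size alpha) (size beta) (size gamma) (size delta) in
  #|[set f : {ffun seq_sub E -> label} |
      is_puzzle (labeling_fun f) alpha beta gamma delta epsilon zeta]|.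

(* Main.v *)
(** Cut the hexagon along the segment joining its NW/N corner to its SE/S
    corner.  Since [beta] and [zeta] have the same content, counting labels
    shows that no edge of the cut carries 10, so the number of puzzles is a sum,
    over the label of the cut, of products of numbers of trapezoidal puzzles,
    and it suffices to exchange the two legs of a trapezoid.  Completing the
    trapezoid to a triangle by a corner in which a sorted string forces the
    filling reduces this to the commutativity of triangular puzzles, applied
    once to the whole triangle and once to its new corner.

    A triangular puzzle is a product [m(b, c)] of strings.  Let [E(q)] move some
    ones of a string one step to the right, with weight [q] for each of them
    (multiplication by elementary symmetric functions).  A Yang-Baxter argument
    gives [E(q) m(b, c) = m(E(q) b, c)]: a row of weighted vertices is pulled
    through the puzzle triangle by triangle.  The operators [E(q)] commute and
    generate all strings from the sorted one, which is the unit of [m]; hence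
    [m] is commutative. *)

Require Import Defs.
From mathcomp Require Import all_boot.
From mathcomp Require Import all_order all_algebra.
From mathcomp Require Import ring zify.
From Stdlib Require Import FunctionalExtensionality.

Set Implicit Arguments.
Unset Strict Implicit.
Unset Printing Implicit Defensive.

Import Order.TTheory GRing.Theory Num.Theory.
Local Open Scope ring_scope.

Local Notation bits := (map label_of_bit).

(** * Sums over labels and over tuples *)

Lemma sum_label (V : nmodType) (F : label -> V) :
  \sum_l F l = F L0 + F L1 + F L10.
Proof.
rewrite (reindex label_of_ord) /=; last first.
  exists ord_of_label => [i _|l _]; last exact: ord_of_labelK.
  by case: i => [[|[|[|]]]] // ?; apply: val_inj.
by rewrite !big_ord_recl big_ord0 addr0 addrA.
Qed.

Lemma sum_tuple0 (A : finType) (V : nmodType) (F : seq A -> V) :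
  \sum_(t : 0.-tuple A) F t = F [::].
Proof.
by rewrite (big_pred1 [tuple]) // => t; apply/esym/eqP; exact: tuple0.
Qed.

Lemma sum_tupleS (A : finType) (V : nmodType) n (F : seq A -> V) :
  \sum_(t : n.+1.-tuple A) F t = \sum_a \sum_(t : n.-tuple A) F (a :: t).
Proof.
rewrite pair_big /=.
rewrite (reindex (fun p : A * n.-tuple A => [tuple of p.1 :: p.2])) //=.
exists (fun t : n.+1.-tuple A => (thead t, [tuple of behead t])).
  by move=> [a t] _ /=; congr pair; apply: val_inj.
by move=> t _; rewrite /= -tuple_eta.
Qed.

Lemma sum_tuple1 (A : finType) (V : nmodType) (F : seq A -> V) :
  \sum_(t : 1.-tuple A) F t = \sum_a F [:: a].
Proof.
rewrite sum_tupleS; apply: eq_bigr => a _.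
exact: (sum_tuple0 (fun t => F (a :: t))).
Qed.

(** * Exchange relations *)

Section Exchange.

Variable F : fieldType.
Implicit Types q : F.

Definition weight (x y z : label) : F := (allowed x y z)%:R.

Lemma weightE x y z :
  weight x y z = match x, y, z with
    | L0, L0, L0 | L1, L1, L1 | L1, L0, L10 | L0, L10, L1 | L10, L1, L0 => 1
    | _, _, _ => 0
    end.
Proof. by case: x; case: y; case: z. Qed.

(* The fillings of the strip between the line [s] and the next, longer line [r],
   both read from NW to SE.  The labels [h] and [g] of the horizontal and
   60-degree edges are met alternately, from the edge [x] on the NW side to the
   edge [y] on the South side. *)
Fixpoint layer (x : label) (s : seq label) (y : label) (r : seq label) : F :=
  match s, r with
  | [::], [:: r0] => weight x r0 y
  | s0 :: s1, r0 :: r1 =>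
      \sum_h weight x r0 h * \sum_g weight s0 h g * layer g s1 y r1
  | _, _ => 0
  end.

(* [K i l l' j] is the weight of a carry [i] which crosses an edge, going from
   NW to SE, changes its label from [l] to [l'], and becomes [j].  The three
   kernels, for the three directions, were found by solving the equations
   [up_exchange] and [down_exchange]. *)
Definition kernel := label -> label -> label -> label -> F.

Definition K60 q : kernel := fun i l l' j =>
  match i, l, l', j with
  | L0, L0, L0, L0 | L0, L1, L1, L0 | L0, L10, L10, L0 | L1, L0, L1, L0
  | L10, L0, L10, L0 | L10, L1, L1, L10 => 1
  | L0, L1, L0, L1 | L0, L10, L0, L10 | L1, L1, L1, L1 | L1, L10, L1, L10
  | L10, L1, L10, L1 | L10, L10, L10, L10 => q
  | _, _, _, _ => 0
  end.

Definition K0 q : kernel := fun i l l' j =>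
  match i, l, l', j with
  | L0, L0, L0, L0 | L0, L0, L10, L1 | L0, L1, L1, L0 | L1, L1, L0, L10
  | L1, L1, L1, L1 | L10, L0, L0, L10 | L10, L0, L1, L1 => 1
  | L1, L10, L0, L0 | L1, L10, L10, L1 => q^-1
  | L1, L0, L0, L1 => - q^-1
  | _, _, _, _ => 0
  end.

Definition K120 q : kernel := fun i l l' j =>
  match i, l, l', j with
  | L0, L0, L0, L0 | L0, L1, L1, L0 | L0, L10, L10, L0 | L1, L0, L0, L1
  | L1, L10, L1, L0 | L10, L0, L1, L0 => 1
  | L0, L1, L0, L10 | L0, L1, L10, L1 | L1, L1, L1, L1 | L10, L1, L1, L10 => q
  | _, _, _, _ => 0
  end.

(** A carry crossing the right side of an upward triangle may instead cross its left side and then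
    its bottom side. This is a finite check over the labels, with [q] invertible because of the
    entries [q^-1] of [K0]. *)
Lemma up_exchange q (nz_q : q != 0) i g h r' j :
  \sum_r weight g r h * K120 q i r r' j =
  \sum_g' \sum_k \sum_h' K60 q i g g' k * K0 q k h h' j * weight g' r' h'.
Proof.
rewrite !sum_label !weightE.
case: r' => //; case: i => //; rewrite /K60 /K0 /K120;
 rewrite ?(mul0r, mulr0, add0r, addr0, mul1r, mulr1);
 case: g => //; rewrite ?(mul0r, mulr0, add0r, addr0, mul1r, mulr1) //;
 case: h; rewrite ?(mul0r, mulr0, add0r, addr0, mul1r, mulr1) //;
 case: j; rewrite ?(mul0r, mulr0, add0r, addr0, mul1r, mulr1) //;
 by rewrite ?(divff nz_q, mulVf nz_q, addNr, subrr, mulNr, mulrN) //.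
Qed.

(** Likewise, crossing the top and then the right side of a downward triangle amounts to crossing
    its left side. *)
Lemma down_exchange q (nz_q : q != 0) i s h' g' j :
  \sum_h \sum_m \sum_g weight s h g * K0 q i h h' m * K60 q m g g' j =
  \sum_s' K120 q i s s' j * weight s' h' g'.
Proof.
rewrite !sum_label !weightE.
case: s; rewrite ?(mul0r, mulr0, add0r, addr0, mul1r, mulr1) //;
 case: i; rewrite /K60 /K0 /K120 ?(mul0r, mulr0, add0r, addr0, mul1r, mulr1) //;
 case: h'; rewrite ?(mul0r, mulr0, add0r, addr0, mul1r, mulr1) //;
 case: g'; rewrite ?(mul0r, mulr0, add0r, addr0, mul1r, mulr1) //;
 case: j; rewrite ?(mul0r, mulr0, add0r, addr0, mul1r, mulr1) //;
 by rewrite ?(divff nz_q, mulVf nz_q, addNr, subrr, mulNr, mulrN) //.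
Qed.

End Exchange.

Lemma sum_delta_l (F : pzSemiRingType) (A : finType) (a : A) (f : A -> F) :
  \sum_b (a == b)%:R * f b = f a.
Proof.
rewrite (bigD1 a) //= eqxx mul1r big1 ?addr0 // => b nab.
by rewrite eq_sym (negbTE nab) mul0r.
Qed.

Lemma sum_delta_r (F : pzSemiRingType) (A : finType) (a : A) (f : A -> F) :
  \sum_b f b * (b == a)%:R = f a.
Proof.
rewrite (bigD1 a) //= eqxx mulr1 big1 ?addr0 // => b nab.
by rewrite (negbTE nab) mulr0.
Qed.

Section Rows.

Variable F : fieldType.
Implicit Types q : F.

Local Notation weight := (weight F).

Fixpoint strip (K : kernel F) (i : label) (s s' : seq label) (j : label) : F :=
  match s, s' with
  | [::], [::] => (i == j)%:R
  | a :: s1, a' :: s1' => \sum_k K i a a' k * strip K k s1 s1' j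
  | _, _ => 0
  end.

(** The carry crossing the outer line is pushed inwards: it crosses the NW edge, the inner line and
    then the South edge. Each induction step passes one upward and one downward triangle. *)
Lemma layer_exchange q (nz_q : q != 0) g s y r' i j :
  size r' = (size s).+1 ->
  \sum_(r : (size s).+1.-tuple label) layer F g s y r *
      strip (K120 q) i r r' j =
  \sum_g' \sum_k K60 q i g g' k *
    \sum_(s' : (size s).-tuple label) \sum_l strip (K120 q) k s s' l *
      \sum_y' K0 q l y y' j * layer F g' s' y' r'.
Proof.
elim: s g i r' => [|s0 s IHs] g i [|r0' r'] //= [sz_r'].
  case: r' sz_r' => // _.
  rewrite (sum_tuple1 (fun r : seq label => layer F g [::] y r *
    strip (K120 q) i r [:: r0'] j)) /=.
  under eq_bigr => r _ do rewrite sum_delta_r.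
  rewrite up_exchange //; apply: eq_bigr => g' _; apply: eq_bigr => k _.
  rewrite (sum_tuple0 (fun s' : seq label => \sum_l strip (K120 q) k [::] s' l *
      \sum_y' K0 q l y y' j * layer F g' s' y' [:: r0'])) /= sum_delta_l
          big_distrr /=.
  by apply: eq_bigr => y' _; rewrite mulrA.
(* The first upward triangle is isolated: the sum over [r0] is the left side of [up_exchange]. *)
transitivity (\sum_h \sum_m (\sum_r0 weight g r0 h * K120 q i r0 r0' m) *
   \sum_g1 weight s0 h g1 *
     \sum_(r : (size s).+1.-tuple label)
        layer F g1 s y r * strip (K120 q) m r r' j).
  rewrite (sum_tupleS _ (fun r : seq label => layer F g (s0 :: s) y r *
    strip (K120 q) i r (r0' :: r') j)) /=.
  transitivity (\sum_r0 \sum_h \sum_m weight g r0 h * K120 q i r0 r0' m *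
     \sum_g1 \sum_(r : (size s).+1.-tuple label) weight s0 h g1 *
         (layer F g1 s y r * strip (K120 q) m r r' j)).
    apply: eq_bigr => r0 _.
    under eq_bigr => r _ do rewrite big_distrl /=.
    rewrite exchange_big /=; apply: eq_bigr => h _.
    under eq_bigr => r _ do rewrite big_distrr /=.
    rewrite exchange_big /=; apply: eq_bigr => m _.
    rewrite [X in _ = _ * X]exchange_big big_distrr /=.
    apply: eq_bigr => r _; rewrite !big_distrr big_distrl /=.
    by apply: eq_bigr => g1 _; ring.
  rewrite exchange_big /=; apply: eq_bigr => h _.
  rewrite exchange_big /=; apply: eq_bigr => m _.
  rewrite big_distrl /=; apply: eq_bigr => r0 _; congr (_ * _).
  by apply: eq_bigr => g1 _; rewrite big_distrr.
pose W k g' := \sum_(s' : (size s).-tuple label)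
  \sum_l strip (K120 q) k s s' l *
      \sum_y' K0 q l y y' j * layer F g' s' y' r'.
(* After [up_exchange] and the induction hypothesis, the triple sum over [h], [m], [g1] is the left
   side of [down_exchange]. *)
transitivity (\sum_g' \sum_k K60 q i g g' k * \sum_h' weight g' r0' h' *
   \sum_g1' \sum_k1 (\sum_h \sum_m \sum_g1 weight s0 h g1 * K0 q k h h' m *
       K60 q m g1 g1' k1)
     * W k1 g1').
  transitivity (\sum_h \sum_m \sum_g' \sum_k \sum_h' \sum_g1 \sum_g1' \sum_k1
      K60 q i g g' k * weight g' r0' h' *
      (weight s0 h g1 * K0 q k h h' m * K60 q m g1 g1' k1) * W k1 g1').
    apply: eq_bigr => h _; apply: eq_bigr => m _.
    rewrite up_exchange // big_distrl; apply: eq_bigr => g' _.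
    rewrite big_distrl; apply: eq_bigr => k _.
    rewrite big_distrl; apply: eq_bigr => h' _.
    rewrite big_distrr; apply: eq_bigr => g1 _ /=.
    rewrite IHs // !big_distrr; apply: eq_bigr => g1' _ /=.
    rewrite !big_distrr; apply: eq_bigr => k1 _ /=.
    by rewrite /W; ring.
  under eq_bigr => h _ do rewrite exchange_big /=.
  rewrite exchange_big /=; apply: eq_bigr => g' _.
  under eq_bigr => h _ do rewrite exchange_big /=.
  rewrite exchange_big /=; apply: eq_bigr => k _.
  under eq_bigr => h _ do rewrite exchange_big /=.
  rewrite exchange_big big_distrr /=; apply: eq_bigr => h' _.
  under eq_bigr => h _ do (under eq_bigr => m _ do rewrite exchange_big /=).
  under eq_bigr => h _ do rewrite exchange_big /=.
  rewrite exchange_big !big_distrr /=; apply: eq_bigr => g1' _.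
  under eq_bigr => h _ do (under eq_bigr => m _ do rewrite exchange_big /=).
  under eq_bigr => h _ do rewrite exchange_big /=.
  rewrite exchange_big !big_distrr /=; apply: eq_bigr => k1 _.
  rewrite big_distrl !big_distrr; apply: eq_bigr => h _ /=.
  rewrite big_distrl !big_distrr; apply: eq_bigr => m _ /=.
  rewrite big_distrl !big_distrr; apply: eq_bigr => g1 _ /=.
  by ring.
apply: eq_bigr => g' _; apply: eq_bigr => k _; congr (_ * _).
rewrite (sum_tupleS _ (fun s' : seq label =>
  \sum_l strip (K120 q) k (s0 :: s) s' l *
      \sum_y' K0 q l y y' j * layer F g' s' y' (r0' :: r'))) /=.
transitivity (\sum_s0' \sum_h' \sum_g1' \sum_k1
  \sum_(s' : (size s).-tuple label) \sum_l \sum_y'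
    weight g' r0' h' * (K120 q k s0 s0' k1 * weight s0' h' g1') *
    strip (K120 q) k1 s s' l * K0 q l y y' j * layer F g1' s' y' r').
  rewrite [RHS]exchange_big; apply: eq_bigr => h' _ /=.
  rewrite [RHS]exchange_big big_distrr; apply: eq_bigr => g1' _ /=.
  rewrite [RHS]exchange_big big_distrr; apply: eq_bigr => k1 _ /=.
  rewrite down_exchange // big_distrl big_distrr; apply: eq_bigr => s0' _ /=.
  rewrite !big_distrr; apply: eq_bigr => s' _ /=.
  rewrite !big_distrr; apply: eq_bigr => l _ /=.
  rewrite !big_distrr; apply: eq_bigr => y' _ /=.
  by ring.
apply: eq_bigr => s0' _.
transitivity (\sum_(s' : (size s).-tuple label) \sum_l \sum_y' \sum_k1
  \sum_h' \sum_g1'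
    weight g' r0' h' * (K120 q k s0 s0' k1 * weight s0' h' g1') *
    strip (K120 q) k1 s s' l * K0 q l y y' j * layer F g1' s' y' r').
  under eq_bigr => h' _ do rewrite exchange_big.
  rewrite exchange_big; under eq_bigr => k1 _ do rewrite pair_big.
  under eq_bigr => k1 _ do rewrite exchange_big /=.
  rewrite exchange_big; apply: eq_bigr => s' _ /=.
  under eq_bigr => k1 _ do rewrite exchange_big /=.
  rewrite exchange_big; apply: eq_bigr => l _ /=.
  under eq_bigr => k1 _ do rewrite exchange_big /=.
  rewrite exchange_big; apply: eq_bigr => y' _ /=.
  by apply: eq_bigr => k1 _; rewrite pair_big.
apply: eq_bigr => s' _; apply: eq_bigr => l _.
rewrite exchange_big big_distrl; apply: eq_bigr => k1 _ /=.
rewrite big_distrr; apply: eq_bigr => y' _ /=.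
rewrite !big_distrr; apply: eq_bigr => h' _ /=.
rewrite !big_distrr; apply: eq_bigr => g1' _ /=.
by ring.
Qed.

End Rows.

Lemma sum_tupleSr (A : finType) (V : nmodType) n (F : seq A -> V) :
  \sum_(t : n.+1.-tuple A) F t = \sum_(t : n.-tuple A) \sum_a F (rcons t a).
Proof.
elim: n F => [|n IHn] F.
  by rewrite sum_tuple1 (sum_tuple0 (fun t => \sum_a F (rcons t a))).
rewrite sum_tupleS; under eq_bigr => a _ do rewrite (IHn (fun t => F (a :: t))).
by rewrite (sum_tupleS _ (fun t => \sum_a F (rcons t a))).
Qed.

Section Trapezoid.

Variable F : fieldType.
Implicit Types (q : F) (w : seq (label * label)).

Lemma strip_rcons (K : kernel F) i s a s' a' j : size s = size s' ->
  strip K i (rcons s a) (rcons s' a') j = \sum_l strip K i s s' l * K l a a' j.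
Proof.
elim: s s' i => [|b s IHs] [|b' s'] i //= => [_|[/IHs IH]].
  by rewrite sum_delta_l; under eq_bigr => k _ do rewrite eq_sym mulrC;
    rewrite sum_delta_l.
under eq_bigr => k _ do rewrite IH big_distrr /=.
rewrite exchange_big; apply: eq_bigr => l _; rewrite big_distrl /=.
by apply: eq_bigr => k _; rewrite mulrA.
Qed.

(* The letters of [w] are the pairs of labels on the NW and South sides, the
   outer layers (farthest from [s]) coming first. *)
Fixpoint trap w (s r : seq label) : F :=
  match w with
  | [::] => (s == r)%:R
  | (x, y) :: w1 =>
      \sum_(t : (size s + size w1).-tuple label) trap w1 s t * layer F x t y r
  end.

Arguments trap : simpl never.

Lemma trap_cons n x y w s r : (size s + size w)%N = n ->
  trap ((x, y) :: w) s r = \sum_(t : n.-tuple label) trap w s t *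
    layer F x t y r.
Proof. by move=> <-. Qed.

(** [layer_exchange] is applied from the outermost layer inwards. The carry meets the NW side from
    its outer end, then the South side from its inner end; this accounts for [rev]. *)
Lemma trap_exchange q (nz_q : q != 0) w r' i j : size r' = size w ->
  \sum_(r : (size w).-tuple label) trap w [::] r * strip (K120 q) i r r' j =
  \sum_(b : (size w).-tuple label) \sum_k strip (K60 q) i (unzip1 w) b k *
    \sum_(c : (size w).-tuple label) strip (K0 q) k (rev (unzip2 w)) c j *
      trap (zip b (rev c)) [::] r'.
Proof.
elim: w r' i j => [|[x y] w IHw] r' i j /=.
  case: r' => // _.
  rewrite [LHS](sum_tuple0 (fun r => trap [::] [::] r *
    strip (K120 q) i r [::] j)).
  pose f b c k := strip (K0 q) k (rev [::]) c j *
    trap (zip b (rev c)) [::] [::].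
  rewrite (sum_tuple0 (fun b => \sum_k strip (K60 q) i [::] b k *
    \sum_(c : 0.-tuple label) f b c k)) /=.
  under eq_bigr => k _ do rewrite (sum_tuple0 (fun c => f [::] c k)).
  by rewrite sum_delta_l /f /trap /= mul1r mulr1.
move=> sz_r'.
transitivity (\sum_(t : (size w).-tuple label) trap w [::] t *
  \sum_x' \sum_k K60 q i x x' k *
    \sum_(t' : (size w).-tuple label) \sum_l strip (K120 q) k t t' l *
      \sum_y' K0 q l y y' j * layer F x' t' y' r').
  under eq_bigr => r _ do rewrite (@trap_cons (size w)) // big_distrl /=.
  rewrite exchange_big; apply: eq_bigr => t _ /=.
  under eq_bigr => r _ do rewrite -mulrA.
  rewrite -big_distrr /=; congr (_ * _).
  have := @layer_exchange F q nz_q x t y r' i j; rewrite size_tuple.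
  by apply.
(* Summing over the line [t] first exposes the left side of the induction hypothesis, with carry
   from [k] to [l]. *)
transitivity (\sum_x' \sum_k K60 q i x x' k * \sum_(t' : (size w).-tuple label)
  \sum_l (\sum_(t : (size w).-tuple label) trap w [::] t *
      strip (K120 q) k t t' l) *
    \sum_y' K0 q l y y' j * layer F x' t' y' r').
  under eq_bigr => t _ do rewrite big_distrr /=.
  rewrite exchange_big; apply: eq_bigr => x' _ /=.
  under eq_bigr => t _ do rewrite big_distrr /=.
  rewrite exchange_big; apply: eq_bigr => k _ /=.
  under eq_bigr => t _ do rewrite mulrCA.
  rewrite -big_distrr /=; congr (_ * _).
  under eq_bigr => t _ do rewrite big_distrr /=.
  rewrite exchange_big; apply: eq_bigr => t' _ /=.
  under eq_bigr => t _ do rewrite big_distrr /=.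
  rewrite exchange_big; apply: eq_bigr => l _ /=.
  by rewrite big_distrl; apply: eq_bigr => t _ /=; rewrite mulrA.
pose G b c k := strip (K60 q) i (x :: unzip1 w) b k *
  (strip (K0 q) k (rev (y :: unzip2 w)) c j * trap (zip b (rev c)) [::] r').
transitivity (\sum_(b : (size w).+1.-tuple label) \sum_k
  \sum_(c : (size w).+1.-tuple label) G b c k);
  last by apply: eq_bigr => b _; apply: eq_bigr => k _; rewrite big_distrr.
rewrite (sum_tupleS _ (fun b => \sum_k \sum_(c : (size w).+1.-tuple label)
  G b c k)).
apply: eq_bigr => x' _.
transitivity (\sum_k \sum_(b : (size w).-tuple label)
  \sum_l K60 q i x x' k * strip (K60 q) k (unzip1 w) b l *
  \sum_(c : (size w).-tuple label) \sum_y'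
   (strip (K0 q) l (rev (y :: unzip2 w)) (rcons c y') j *
       trap ((x', y') :: zip b (rev c)) [::] r')).
  apply: eq_bigr => k _.
  transitivity (\sum_(b : (size w).-tuple label) \sum_l
     \sum_(c : (size w).-tuple label) \sum_(t : (size w).-tuple label)
         \sum_m \sum_y'
       K60 q i x x' k * (strip (K60 q) k (unzip1 w) b l *
           (strip (K0 q) l (rev (unzip2 w)) c m *
       trap (zip b (rev c)) [::] t) * (K0 q m y y' j * layer F x' t y' r'))).
    transitivity (\sum_(t : (size w).-tuple label) \sum_m
      \sum_(b : (size w).-tuple label) \sum_l
     \sum_(c : (size w).-tuple label) \sum_y'
       K60 q i x x' k * (strip (K60 q) k (unzip1 w) b l *
           (strip (K0 q) l (rev (unzip2 w)) c m *
       trap (zip b (rev c)) [::] t) * (K0 q m y y' j * layer F x' t y' r'))).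
      rewrite big_distrr; apply: eq_bigr => t _ /=.
      rewrite big_distrr; apply: eq_bigr => m _ /=.
      rewrite IHw ?size_tuple // big_distrl big_distrr;
        apply: eq_bigr => b _ /=.
      rewrite big_distrl big_distrr; apply: eq_bigr => l _ /=.
      rewrite [strip _ _ _ _ _ * _]big_distrr /= big_distrl big_distrr;
        apply: eq_bigr => c _ /=.
      by rewrite !big_distrr; apply: eq_bigr => y' _.
    rewrite pair_big /= exchange_big; apply: eq_bigr => b _ /=.
    rewrite exchange_big; apply: eq_bigr => l _ /=.
    rewrite exchange_big; apply: eq_bigr => c _ /=.
    by rewrite [RHS]pair_big.
  apply: eq_bigr => b _; apply: eq_bigr => l _; rewrite big_distrr.
  apply: eq_bigr => c _; rewrite big_distrr /= pair_big exchange_big.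
  apply: eq_bigr => y' _.
  rewrite rev_cons strip_rcons ?size_rev ?size_map ?size_tuple //.
  rewrite (@trap_cons (size w)) ?size_zip ?size_rev ?size_tuple ?minnn //.
  rewrite big_distrl big_distrr /= -(pair_big xpredT xpredT
    (fun t m => K60 q i x x' k * (strip (K60 q) k (unzip1 w) b l *
    (strip (K0 q) l (rev (unzip2 w)) c m *
       trap (zip b (rev c)) [::] (tval t)) * (K0 q m y y' j *
         layer F x' (tval t) y' r')))) exchange_big /=.
  apply: eq_bigr => m _; rewrite !big_distrr /=; apply: eq_bigr => t _; ring.
rewrite exchange_big; apply: eq_bigr => b _ /=.
rewrite exchange_big; apply: eq_bigr => l _ /=.
rewrite (sum_tupleSr _ (fun c => G (x' :: b) c l)).
rewrite -big_distrl /= big_distrr; apply: eq_bigr => c _ /=.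
rewrite big_distrr; apply: eq_bigr => y' _ /=.
by rewrite /G rev_rcons.
Qed.

End Trapezoid.

#[global] Arguments trap F w s r : simpl never.

(** * Vertical strips *)

Lemma bits_inj : injective (map label_of_bit).
Proof. by apply: inj_map => [[] []]. Qed.

Lemma sum_bits (V : nmodType) n (G : seq label -> V) :
  (forall t, L10 \in t -> G t = 0) ->
  \sum_(t : n.-tuple label) G t = \sum_(b : n.-tuple bool) G (bits b).
Proof.
elim: n G => [|n IHn] G G0.
  by rewrite sum_tuple0 (sum_tuple0 (fun b => G (bits b))).
rewrite sum_tupleS (sum_tupleS _ (fun b => G (bits b))) sum_label.
rewrite [X in _ + X]big1 ?addr0 => [|t _]; last by rewrite G0 ?mem_head.
rewrite (IHn (fun t => G (L0 :: t))) ?(IHn (fun t => G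
  (L1 :: t))) ?big_bool 1?addrC //.
  by move=> t t10; rewrite G0 // inE t10 orbT.
by move=> t t10; rewrite G0 // inE t10 orbT.
Qed.

Section BinaryStrips.

Variable F : fieldType.
Implicit Types q : F.

(* The ones of [s] move to the right by at most one step; [c] tells whether a
   one is being carried to the first position. *)
Fixpoint vstrip q (c : bool) (s s' : seq bool) : F :=
  match s, s' with
  | [::], [::] => (~~ c)%:R
  | a :: s1, a' :: s1' =>
      match c, a, a' with
      | false, false, false | false, true, true | true, false, true =>
          vstrip q false s1 s1'
      | false, true, false | true, true, true => q * vstrip q true s1 s1'
      | _, _, _ => 0
      end
  | _, _ => 0
  end.

Lemma strip60_bits q (c : bool) b b' :
  strip (K60 q) (if c then L1 else L0) (bits b) (bits b') L0 = vstrip q c b b'.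
Proof.
elim: b b' c => [|a b IHb] [|a' b'] c //=; first by case: c.
rewrite sum_label.
by case: c; case: a; case: a' => /=; rewrite ?(mul0r, add0r, addr0, mul1r);
  rewrite -?(IHb _ true) -?(IHb _ false).
Qed.

Lemma strip60_no10 q (c : bool) b t : L10 \in t ->
  strip (K60 q) (if c then L1 else L0) (bits b) t L0 = 0.
Proof.
elim: b t c => [|a b IHb] [|a' t] c //=; rewrite inE sum_label =>
  /orP[/eqP<-|t10].
  by case: c; case: a => /=; rewrite !mul0r !addr0.
have IH0 := IHb t false t10; have IH1 := IHb t true t10; rewrite /= in IH0 IH1.
by rewrite IH0 IH1 !mulr0 !add0r; case: c; case: a; case: a'; rewrite /= mul0r.
Qed.

(** By [K0], a carry [L0] leaving a binary edge must have entered as [L0] without changing the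
    label; this propagates backwards from the exit. *)
Lemma strip0_bits q k c t :
  strip (K0 q) k (bits c) t L0 = ((k == L0) && (t == bits c))%:R.
Proof.
elim: c t k => [|a c IHc] [|a' t] k //=; rewrite ?andbT ?andbF //.
under eq_bigr => m _ do rewrite IHc.
have [n1 n10] : (L1 == L0 = false) * (L10 == L0 = false) by [].
rewrite sum_label eqxx n1 n10 /= !mulr0 !addr0 eqseq_cons.
by case: k; case: a; case: a'; rewrite /= ?mul0r ?mul1r.
Qed.

Lemma strip120_bits q (c : bool) b b' :
  strip (K120 q) (if c then L10 else L0) (bits b) (bits b') L0 =
    vstrip q c b b'.
Proof.
elim: b b' c => [|a b IHb] [|a' b'] c //=; first by case: c.
rewrite sum_label.
by case: c; case: a; case: a' => /=; rewrite ?(mul0r, add0r, addr0, mul1r);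
  rewrite -?(IHb _ true) -?(IHb _ false).
Qed.

(** By [K120], a label [L10] becomes binary only by meeting the carry [L1], and from the carries
    [L0] and [L10] this carry arises only by writing an [L10]. *)
Lemma strip120_no10 q (c : bool) t b' : L10 \in t ->
  strip (K120 q) (if c then L10 else L0) t (bits b') L0 = 0.
Proof.
elim: t b' c => [|a t IHt] [|a' b'] c //=;
  rewrite inE sum_label => /orP[/eqP<-|t10].
  by case: c; case: a' => /=; rewrite !mul0r !addr0.
have IH0 := IHt b' false t10; have IH1 := IHt b' true t10;
  rewrite /= in IH0 IH1.
by rewrite IH0 IH1 !mulr0 !addr0 !add0r; case: c; case: a; case: a';
  rewrite /= mul0r.
Qed.

(* The number of triangles with sides [rev b], [r] and [rev c], read clockwise:
   with this orientation the unit is the same string on all sides. *)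
Definition mulstr (b c : seq bool) (r : seq label) : F :=
  trap F (zip (bits b) (rev (bits c))) [::] r.

(** In [trap_exchange] with both outer carries [L0], the South side cannot change, by [strip0_bits];
    the other two strips are binary and become [vstrip]. *)
Lemma mulstr_exchange q (nz_q : q != 0) n (b c r' : n.-tuple bool) :
  \sum_(r : n.-tuple bool) mulstr b c (bits r) * vstrip q false r r' =
  \sum_(b' : n.-tuple bool) vstrip q false b b' * mulstr b' c (bits r').
Proof.
pose w := zip (bits b) (rev (bits c)).
have sz : size (bits b) = size (rev (bits c)).
  by rewrite size_rev !size_map !size_tuple.
have sw : size w = n by rewrite size_zip -sz minnn size_map size_tuple.
have := @trap_exchange F q nz_q w (bits r') L0 L0.
rewrite size_map size_tuple sw => /(_ erefl).
rewrite /w unzip1_zip ?unzip2_zip ?sz // revK.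
rewrite (sum_bits _ (G := fun r => trap F (zip (bits b) (rev (bits c))) [::] r *
   strip (K120 q) L0 r (bits r') L0)); last first.
  by move=> t t10; rewrite (strip120_no10 q false) ?mulr0.
under eq_bigr => r _ do rewrite (strip120_bits q false).
move=> ->.
pose G t := strip (K60 q) L0 (bits b) t L0 *
  trap F (zip t (rev (bits c))) [::] (bits r').
transitivity (\sum_(t : n.-tuple label) G t); last first.
  rewrite sum_bits => [|t t10]; last by rewrite /G
    (strip60_no10 q false) ?mul0r.
  by apply: eq_bigr => b' _; rewrite /G (strip60_bits q false).
apply: eq_bigr => t _.
(* The added sum is zero term by term. In the original sum only [k = L0] and [c' = bits c]
   contribute. *)
transitivity (\sum_k (k == L0)%:R * (strip (K60 q) k (bits b) t k * 0) + G t).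
  rewrite [X in X + _]big1 ?add0r => [|k _]; last by rewrite !mulr0.
  rewrite (bigD1 L0) //= [X in _ + X]big1 ?addr0 => [|k nk]; last first.
    by rewrite big1 ?mulr0 // => c' _; rewrite strip0_bits (negbTE nk) mul0r.
  congr (_ * _); rewrite (bigD1 [tuple of bits c]) //= big1 => [|c' nc].
    by rewrite strip0_bits !eqxx mul1r addr0.
  by rewrite strip0_bits eqxx /= (_ : _ == _ = false) ?mul0r //; apply: negbTE.
by rewrite big1 ?add0r // => k _; rewrite !mulr0.
Qed.

Definition vstrip2 p q i j n (s t : seq bool) :=
  \sum_(s' : n.-tuple bool) vstrip p i s s' * vstrip q j s' t.

Lemma vstrip2_cons p q i j n a s a' t :
  vstrip2 p q i j n.+1 (a :: s) (a' :: t) =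
  match i, a, j, a' with
  | false, false, false, false => vstrip2 p q false false n s t
  | false, false, true, true => vstrip2 p q false false n s t
  | false, true, false, false => p * vstrip2 p q true false n s t + q *
    vstrip2 p q false true n s t
  | false, true, false, true => vstrip2 p q false false n s t
  | false, true, true, true => p * vstrip2 p q true false n s t + q *
    vstrip2 p q false true n s t
  | true, false, false, false => q * vstrip2 p q false true n s t
  | true, false, false, true => vstrip2 p q false false n s t
  | true, false, true, true => q * vstrip2 p q false true n s t
  | true, true, false, false => p * q * vstrip2 p q true true n s t
  | true, true, false, true => p * vstrip2 p q true false n s t
  | true, true, true, true => p * q * vstrip2 p q true true n s t
  | _, _, _, _ => 0
  end.
Proof.
rewrite /vstrip2 (sum_tupleS _ (fun s' => vstrip p i (a :: s) s' *
  vstrip q j s' (a' :: t))) big_bool /=.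
by case: i; case: a; case: j; case: a'; rewrite ?big_distrr -?big_split /=;
  (apply: eq_bigr || apply: big1) => s' _; ring.
Qed.

(* The relations are the components of R T_p T_q = T_q T_p R on the boundary
   state (0, 0), where R is the 4x4 matrix intertwining the two carries. *)
Lemma vstrip2C_aux p q n s t : size s = n -> size t = n ->
  [/\ vstrip2 p q false false n s t = vstrip2 q p false false n s t,
      vstrip2 p q false true n s t = vstrip2 q p false true n s t,
      p * vstrip2 p q true true n s t = q * vstrip2 q p true true n s t
    & p * vstrip2 p q true false n s t + (q - p) *
      vstrip2 p q false true n s t =
      q * vstrip2 q p true false n s t].
Proof.
elim: n s t => [|n IHn] [|a s] [|a' t] //= => [_ _|[sz_s] [sz_t]].
  rewrite /vstrip2.
  do ![rewrite (sum_tuple0 (fun s' => vstrip _ _ [::] s' *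
    vstrip _ _ s' [::]))] => /=.
  by split; ring.
have [e00 e01 e11 e10] := IHn s t sz_s sz_t.
rewrite !vstrip2_cons; case: a; case: a'; split => //;
  rewrite ?mulr0 ?addr0 -?e00 -?e01 -?e10 //;
  try ring.
all: transitivity (p * q * (p * vstrip2 p q true true n s t));
  [ring | rewrite e11; ring].
Qed.

Lemma vstrip2C p q n (s t : n.-tuple bool) :
  \sum_(s' : n.-tuple bool) vstrip p false s s' * vstrip q false s' t =
  \sum_(s' : n.-tuple bool) vstrip q false s s' * vstrip p false s' t.
Proof. by case: (@vstrip2C_aux p q n s t (size_tuple s) (size_tuple t)). Qed.

Definition ones (s : seq bool) := count_mem true s.

Lemma ones_cons a s : ones (a :: s) = (a + ones s)%N.
Proof. by case: a. Qed.

Lemma ones_cat s t : ones (s ++ t) = (ones s + ones t)%N.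
Proof. exact: count_cat. Qed.

(* The sum of the positions of the ones; a strip raises it by the number of ones
   that it moves. *)
Fixpoint deg (s : seq bool) : nat :=
  if s is _ :: s1 then (deg s1 + ones s1)%N else 0%N.

Lemma deg_cat s t : deg (s ++ t) = (deg s + deg t + size s * ones t)%N.
Proof. by elim: s => [|a s IHs] /=; rewrite ?IHs ?ones_cat ?mulSn ?ones_cons;
  lia. Qed.

(** A strip is zero or a monomial in [q] whose exponent counts the ones moved, so coefficients of
    powers of [q] can be compared below. *)
Lemma vstripP c s s' :
  (forall q, vstrip q c s s' = 0) \/
  [/\ (deg s <= deg s')%N, ones s' = (c + ones s)%N
    & forall q, vstrip q c s s' = q ^+ (deg s' - deg s)].
Proof.
elim: s s' c => [|a s IHs] [|a' s'] c; try by left.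
  by case: c; [left | right].
case: c; case: a; case: a'; (try by left) => /=; rewrite ?ones_cons.
- case: (IHs s' true) => [v0|[le_d -> vE]]; [left | right; split; try lia] => q.
    by rewrite v0 mulr0.
  by rewrite vE -exprS; congr (q ^+ _); lia.
- case: (IHs s' false) => [v0|[le_d -> vE]]; [by left | right; split;
  try lia] => q.
  by rewrite vE; congr (q ^+ _); lia.
- case: (IHs s' false) => [v0|[le_d -> vE]]; [by left | right; split;
  try lia] => q.
  by rewrite vE; congr (q ^+ _); lia.
- case: (IHs s' true) => [v0|[le_d -> vE]]; [left | right; split; try lia] => q.
    by rewrite v0 mulr0.
  by rewrite vE -exprS; congr (q ^+ _); lia.
- case: (IHs s' false) => [v0|[le_d -> vE]]; [by left | right; split;
  try lia] => q.
  by rewrite vE; congr (q ^+ _); lia.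
Qed.

Lemma vstrip_count q c s s' : vstrip q c s s' != 0 ->
  ones s' = (c + ones s)%N.
Proof. by case: (vstripP c s s') => [-> /eqP|[]]. Qed.

Lemma vstrip_nseq q m s s' :
  vstrip q false (nseq m true ++ s) (nseq m true ++ s') = vstrip q false s s'.
Proof. by elim: m. Qed.

Lemma vstrip_rcons q c s :
  vstrip q c (rcons s false) (c :: s) = q ^+ ones s.
Proof.
elim: s c => [|a s IHs] c; first by case: c.
by case: c; case: a; rewrite /= IHs //= ?exprS.
Qed.

(** Moving every one yields [c :: s]; each one that stays put lowers the degree. *)
Lemma vstrip_rcons_lt q c s s' : vstrip q c (rcons s false) s' != 0 ->
  s' = c :: s \/ (deg s' < deg (c :: s))%N.
Proof.
elim: s s' c => [|a s IHs] [|a' s'] c; rewrite ?eqxx //.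
  by case: s' => [|? []]; case: c; case: a' => /=; rewrite ?mulr0 ?eqxx //;
    left.
case: c; case: a; case: a'; rewrite /= ?eqxx ?mulf_eq0 ?negb_or // => nz.
- case/andP: nz => _ nz; have := vstrip_count nz;
  case: (IHs _ _ nz) => [->|/=]; first by left.
  by rewrite -cats1 ones_cat ?ones_cons /=; right; lia.
- have := vstrip_count nz; case: (IHs _ _ nz) => [->|/=]; first by left.
  by rewrite -cats1 ones_cat ?ones_cons /=; right; lia.
- have := vstrip_count nz; case: (IHs _ _ nz) => [->|/=];
  rewrite -cats1 ones_cat ?ones_cons /=; right; lia.
- case/andP: nz => _ nz; have := vstrip_count nz;
  case: (IHs _ _ nz) => [->|/=]; first by left.
  by rewrite -cats1 ones_cat ?ones_cons /=; right; lia.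
- have := vstrip_count nz; case: (IHs _ _ nz) => [->|/=]; first by left.
  by rewrite -cats1 ones_cat ?ones_cons /=; right; lia.
Qed.

End BinaryStrips.

(** * Generation of all strings by strips *)

Lemma poly_eq0_of_roots (R : numFieldType) (p : {poly R}) :
  (forall q, q != 0 -> p.[q] = 0) -> p = 0.
Proof.
move=> p0; apply/eqP/negPn/negP => nz_p.
(* In characteristic zero the numbers 1, ..., [size p] are distinct and nonzero: too many roots. *)
pose rs := [seq i.+1%:R : R | i <- iota 0 (size p)].
suff: (size rs < size p)%N by rewrite size_map size_iota ltnn.
apply: max_poly_roots => //.
  by apply/allP => _ /mapP[i _ ->]; apply/rootP/p0; rewrite pnatr_eq0.
by rewrite map_inj_uniq ?iota_uniq // => i j /eqP; rewrite eqr_nat => /eqP[].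
Qed.

Lemma ones_nseq m a : ones (nseq m a) = (a * m)%N.
Proof. by rewrite /ones count_nseq; case: a. Qed.

Lemma leading_onesP s :
  (exists m j, s = nseq m true ++ nseq j false) \/
  (exists m u, s = nseq m true ++ false :: u /\ (0 < ones u)%N).
Proof.
elim: s => [|[] s IHs]; first by left; exists 0, 0.
  case: IHs => [[m [j ->]]|[m [u [-> u_gt0]]]].
    by left; exists m.+1, j.
  by right; exists m.+1, u.
have [s0|s_gt0] := posnP (ones s); last by right; exists 0, s.
left; exists 0, (size s).+1; congr cons; apply/all_pred1P/allP => a a_s.
by case: a a_s => //; rewrite -has_pred1 has_count -/(ones s) s0.
Qed.

(* [s = 1^m 0 u] is the highest string in the support of the strips applied to
   [1^m u 0]; the other strings of the same degree have fewer leading ones. *)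
Lemma vstrip_generation (A : Type) n k (G : seq bool -> A -> rat) :
  (forall a, G (nseq k true ++ nseq (n - k) false) a = 0) ->
  (forall s : n.-tuple bool, ones s = k -> (forall a, G s a = 0) ->
     forall q, q != 0 -> forall a,
       \sum_(s' : n.-tuple bool) vstrip q false s s' * G s' a = 0) ->
  forall s : n.-tuple bool, ones s = k -> forall a, G s a = 0.
Proof.
move=> G0 G_strip.
suff ind d l (s : n.-tuple bool) : deg s = d -> (index false s < l)%N ->
    ones s = k -> forall a, G s a = 0.
  by move=> s; apply: (ind (deg s) (index false s).+1).
(* The outer induction is on the degree, the inner one on a bound for the number of leading ones. *)
elim/ltn_ind: d l s => d IHd; elim => [|l IHl] s // ds ls os a.
case: (leading_onesP s) => [[m [j def_s]]|[m [u [def_s u_gt0]]]].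
  move: os (size_tuple s) (G0 a); rewrite {}def_s ones_cat !ones_nseq.
  rewrite size_cat !size_nseq mul1n addn0 => -> <-.
  by rewrite addKn.
have sz_u : (m + (size u).+1)%N = n.
  by rewrite -(size_tuple s) def_s size_cat size_nseq.
pose s1 := nseq m true ++ rcons u false.
have sz_s1 : size s1 == n by rewrite size_cat size_nseq size_rcons sz_u.
have os1 : ones s1 = k.
  by rewrite -os def_s /s1 -cats1 !ones_cat addn0.
have ds1 : (deg s1 + ones u)%N = d.
  rewrite -ds def_s /s1 -cats1 !deg_cat !ones_cat !ones_cons /= -/(ones u); lia.
have Gs1 a' : G s1 a' = 0.
  have lt_d : (deg s1 < d)%N by lia.
  exact: (IHd _ lt_d (index false s1).+1 (Tuple sz_s1)).
(* By [vstripP], the value of [p] at [q] is the sum in [G_strip] for [s1]. Its coefficient of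
   exponent [ones u] collects the strings of degree [d]. *)
pose p := \sum_(s' : n.-tuple bool)
  (vstrip 1 false s1 s' * G s' a) *: 'X^(deg s' - deg s1) : {poly rat}.
have p0 : p = 0.
  apply: poly_eq0_of_roots => q nz_q.
  rewrite -[RHS](G_strip (Tuple sz_s1) os1 Gs1 q nz_q a) horner_sum.
  apply: eq_bigr => s' _; rewrite hornerZ hornerXn /=.
  case: (vstripP rat false s1 s') => [v0|[_ _ vE]]; first by rewrite !v0 !mul0r.
  by rewrite !vE expr1n mul1r mulrC.
have := congr1 (fun r : {poly rat} => r`_(ones u)) p0.
rewrite coef0 coef_sum (bigD1 s) //= big1 => [|s' ns'].
  rewrite coefZ coefXn addr0 [X in vstrip _ _ _ X]def_s vstrip_nseq
    vstrip_rcons expr1n mul1r.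
  by rewrite (_ : _ == _) ?mulr1 // ds; apply/eqP; lia.
rewrite coefZ coefXn; case: eqP => [d_eq|_]; last by rewrite mulr0.
have [->|nz_v] := eqVneq (vstrip (1 : rat) false s1 s') 0;
  first by rewrite !mul0r.
case: (vstripP rat false s1 s') => [v0|[le_d os' _]];
  first by rewrite v0 eqxx in nz_v.
have ds' : deg s' = d by lia.
rewrite (IHl s') ?mulr0 ?mul0r ?os' //.
have lead_s : index false s = m.
  by rewrite def_s index_cat size_nseq mem_nseq andbF /= addn0.
(* With at least [m] leading ones, [s'] would by [vstrip_rcons_lt] be [s] itself or have degree
   below [d]; both are excluded. *)
rewrite lead_s ltnS in ls; apply: leq_trans ls; rewrite ltnNge;
  apply/negP => le_m.
case/eqP: ns'; apply: val_inj => /=.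
have def_s' : val s' = nseq m true ++ drop m s'.
  rewrite -[LHS](cat_take_drop m); congr (_ ++ _).
  have sz_t : size (take m s') = m by rewrite size_takel //
    size_tuple -sz_u leq_addr.
  rewrite -{2}sz_t; apply/all_pred1P/allP => b b_t.
  by case: b b_t => // /index_ltn; rewrite ltnNge le_m.
rewrite def_s' vstrip_nseq in nz_v.
case: (vstrip_rcons_lt nz_v) => [e|lt_d]; first by rewrite def_s' e def_s.
have := vstrip_count nz_v; rewrite -cats1 ones_cat ones_cons /= => od.
move: ds'; rewrite -ds def_s def_s' !deg_cat ones_cons size_nseq -/(ones _).
move: lt_d; rewrite od /= -/(ones u); lia.
Qed.

(** * Triangular and trapezoidal puzzles *)

Lemma sum_delta_tuple (F : pzSemiRingType) (A : finType) n (u : seq A) (f :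
  seq A -> F) :
  size u = n -> \sum_(t : n.-tuple A) ((t : seq A) == u)%:R * f t = f u.
Proof.
move=> sz_u; rewrite (bigD1 (tcast sz_u (in_tuple u))) //= val_tcast eqxx mul1r.
rewrite big1 ?addr0 // => t; rewrite -val_eqE /= val_tcast /= => /negbTE ->.
by rewrite mul0r.
Qed.

Lemma sum_neq0 (V : nmodType) (I : finType) (f : I -> V) :
  \sum_i f i != 0 -> exists i, f i != 0.
Proof.
have [i nz_i _|f0] := pickP (fun i => f i != 0); first by exists i.
by rewrite big1 ?eqxx // => i _; apply/eqP; rewrite -[_ == _]negbK f0.
Qed.

Definition simp0 := (mul0r, mulr0, mul1r, addr0, add0r).

Section Identity.

Variable F : fieldType.

(* The line reached from the empty one when the NW side, read from the top, is
   [1^j 0^m] and the South side, read from the left, is [c]. *)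
Fixpoint mark (j : nat) (c : seq bool) : seq label :=
  match c, j with
  | [::], _ => [::]
  | false :: c1, _ => L0 :: mark j c1
  | true :: c1, 0 => L10 :: mark 0 c1
  | true :: c1, j1.+1 => L1 :: mark j1 c1
  end.

Lemma size_mark j c : size (mark j c) = size c.
Proof. by elim: c j => [|[] c IHc] [|j] //=; rewrite IHc. Qed.

Lemma mark_ones c : mark (ones c) c = bits c.
Proof. by elim: c => [|[] c IHc] //=; rewrite -[in RHS]IHc; case: (ones c). Qed.

Lemma layer_mark0 c y r :
  layer F L0 (mark 0 c) (label_of_bit y) r = (r == mark 0 (rcons c y))%:R.
Proof.
elim: c r => [|a c IHc] r.
  by case: r => [|[] [|r1 r]]; case: y; rewrite /= ?weightE.
case: r => [|r0 r]; first by case: a.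
by case: a; rewrite /= !sum_label !weightE ?simp0; case: r0;
  rewrite ?simp0 ?IHc.
Qed.

(** The filling is forced: the NW label [L1] turns the first one of [rcons c y] not yet marked into
    [L1]. The bound on [j] provides such a one. *)
Lemma layer_mark j c y r : (j < ones (rcons c y))%N ->
  layer F L1 (mark j c) (label_of_bit y) r = (r == mark j.+1 (rcons c y))%:R.
Proof.
elim: c j r => [|a c IHc] j r.
  by case: r => [|[] [|r1 r]]; case: y; case: j => //= _; rewrite ?weightE.
case: r => [|r0 r]; first by case: a; case: j.
rewrite rcons_cons ones_cons => lt_j.
case: a lt_j; [case: j => [|j]|]; rewrite /= !sum_label !weightE ?simp0 => lt_j;
  by case: r0; rewrite ?simp0 ?layer_mark0 ?IHc.
Qed.

Lemma trap_mark j m c r : size c = (j + m)%N -> (j <= ones c)%N ->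
  trap F (zip (nseq j L1 ++ nseq m L0) (rev (bits c))) [::] r =
    (r == mark j c)%:R.
Proof.
elim: j m c r => [|j IHj] m c r.
  elim: m c r => [|m IHm] c r; first by case: c => // _ _;
    rewrite /trap /= eq_sym.
  case/lastP: c => // c y; rewrite size_rcons => -[sz_c] _.
  have sz : size (zip (nseq m L0) (rev (bits c))) = m.
    by rewrite size_zip size_nseq size_rev size_map sz_c minnn.
  rewrite map_rcons rev_rcons /= (@trap_cons _ m) //.
  under eq_bigr => t _ do rewrite IHm //.
  by rewrite (sum_delta_tuple (fun t => layer F L0 t
    (label_of_bit y) r)) ?size_mark // layer_mark0.
case/lastP: c => // c y; rewrite size_rcons => -[sz_c] lt_j.
have sz : size (zip (nseq j L1 ++ nseq m L0) (rev (bits c))) = (j + m)%N.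
  by rewrite size_zip size_cat !size_nseq size_rev size_map sz_c minnn.
rewrite map_rcons rev_rcons /= (@trap_cons _ (j + m)) //.
under eq_bigr => t _.
  rewrite IHj //; first over.
  by move: lt_j; rewrite -cats1 ones_cat; case: y;
    rewrite /= ?addn1 ?addn0 // => /ltnW.
by rewrite (sum_delta_tuple (fun t => layer F L1 t
  (label_of_bit y) r)) ?size_mark // layer_mark.
Qed.

Definition idstr n k := nseq k true ++ nseq (n - k) false.

(** After [ones c] layers with NW label [L1], every one of [c] is marked, so the outer line is
    [c]. *)
Lemma mulstr_idl n k c r : size c = n -> ones c = k ->
  mulstr F (idstr n k) c r = (r == bits c)%:R.
Proof.
move=> sz_c oc; have le_kn : (k <= n)%N by rewrite -oc -sz_c; apply: count_size.
rewrite /mulstr /idstr map_cat !map_nseq trap_mark ?subnKC // ?oc //.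
by rewrite -oc mark_ones.
Qed.

(** An upward piece with left, right, bottom labels x, r, h satisfies [x ≠ 0] = [r = 1] + [h = 10]
    and [r ≠ 0] = [x = 10] + [h = 1]. A downward piece with left, top, right labels s, h, g
    satisfies [s = 1] + [h = 10] = [g ≠ 0] and [s ≠ 0] = [h = 1] + [g = 10]. These are summed along
    the strip. *)
Lemma layer_content x s y r : layer F x s y r != 0 ->
  (count_mem L1 r + (y == L10) = count_mem L1 s + (x != L0))%N /\
  (count (predC1 L0) r = count (predC1 L0) s + (x == L10) + (y == L1))%N.
Proof.
elim: s x r => [|s0 s IHs] x [|r0 r] /=; rewrite ?eqxx //.
  case: r => [|? ?]; rewrite ?eqxx //= weightE.
  by case: x; case: y; case: r0; rewrite ?eqxx.
case/sum_neq0 => h; rewrite mulf_eq0 negb_or weightE => /andP[nz_h].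
case/sum_neq0 => g; rewrite mulf_eq0 negb_or weightE => /andP[nz_g] /IHs[e1 e2].
move: nz_h nz_g e1 e2.
by case: x; case: h; case: r0; rewrite ?eqxx // => _; case: g; case: s0;
  rewrite ?eqxx //= => _ e1 e2; lia.
Qed.
End Identity.

(** * Conservation of labels and commutativity *)

Section Symmetry.

Variable F : fieldType.

Lemma trap_content b c s r : size b = size c ->
  trap F (zip (bits b) (rev (bits c))) s r != 0 ->
  (count_mem L1 r = count_mem L1 s + ones b)%N /\
  (count (predC1 L0) r = count (predC1 L0) s + ones c)%N.
Proof.
elim: b c r => [|x b IHb] c r.
  case: c => // _; rewrite /trap /=; case: (s =P r) => [-> _|_];
    last by rewrite eqxx.
  by rewrite !addn0.
case/lastP: c => // c y; rewrite size_rcons => -[sz_b].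
rewrite map_rcons rev_rcons /= (@trap_cons _ _ _ _ _ _ _ erefl) => /sum_neq0[t].
rewrite mulf_eq0 negb_or => /andP[/IHb[//|e1 e2]] /layer_content[].
rewrite e1 e2 -cats1 ones_cat !ones_cons => {e1 e2}.
by case: x; case: y => /=; rewrite /ones /=; split; lia.
Qed.

Lemma no10_content s : (L10 \notin s) = (count_mem L1 s == count (predC1 L0) s).
Proof.
have -> : count (predC1 L0) s = (count_mem L1 s + count_mem L10 s)%N.
  by elim: s => //= a s ->; case: a => /=; lia.
by rewrite -{1}[count_mem L1 s]addn0 eqn_add2l eq_sym; apply: esym;
  apply: (sameP eqP count_memPn).
Qed.

(** Sides of equal content raise both counts of [trap_content] equally, and a line avoids [L10]
    exactly when the two counts agree. *)
Lemma trap_no10 b c s r : size b = size c -> ones b = ones c ->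
  L10 \notin s -> L10 \in r -> trap F (zip (bits b) (rev (bits c))) s r = 0.
Proof.
move=> sz_b ob s10 r10; apply/eqP/negPn/negP => /(trap_content sz_b) [e1 e2].
by move: r10; rewrite -[_ \in _]negbK no10_content e1 e2 ob eqn_add2r
  -no10_content s10.
Qed.

Lemma trap_size w s r : trap F w s r != 0 -> size r = (size s + size w)%N.
Proof.
case: w => [|[x y] w].
  by rewrite /trap; case: (s =P r) => [->|]; rewrite ?addn0 ?eqxx.
rewrite (@trap_cons _ _ _ _ _ _ _ erefl) => /sum_neq0[t].
rewrite mulf_eq0 negb_or => /andP[_ nz].
suff -> : size r = (size t).+1 by rewrite size_tuple addnS.
move: x (val t) nz => x {}t; elim: t x r => [|s0 t IHt] x [|r0 r];
  rewrite ?eqxx //.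
  by case: r => [|? ?] //=; rewrite eqxx.
by case/sum_neq0 => h; rewrite mulf_eq0 negb_or => /andP[_ /sum_neq0[g]];
  rewrite mulf_eq0 negb_or => /andP[_ /IHt] /= ->.
Qed.

Lemma trap_cat w1 w2 s r :
  trap F (w1 ++ w2) s r =
  \sum_(t : (size s + size w2).-tuple label) trap F w2 s t * trap F w1 t r.
Proof.
elim: w1 r => [|[x y] w1 IHw] r; rewrite ?cat_cons.
  have [sz_r|nsz_r] := eqVneq (size r) (size s + size w2)%N; rewrite /=.
    under eq_bigr => t _ do rewrite mulrC.
    by rewrite (sum_delta_tuple (fun t => trap F w2 s t)).
  rewrite big1 => [|t _].
    by apply/eqP/negPn/negP => /trap_size; apply/eqP.
  rewrite /(trap F [::]) [X in _ * X](_ : _ = 0) ?mulr0 //.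
  rewrite (_ : (_ == _) = false) //; apply: contra_neqF nsz_r => /eqP <-.
  by rewrite size_tuple.
rewrite (@trap_cons _ _ _ _ _ _ _ erefl).
under eq_bigr => u _ do rewrite IHw big_distrl /=.
rewrite exchange_big; apply: eq_bigr => t _ /=.
rewrite (@trap_cons _ (size s + size (w1 ++ w2))).
  by rewrite big_distrr; apply: eq_bigr => u _ /=; rewrite mulrA.
by rewrite size_tuple size_cat addnAC addnA.
Qed.

End Symmetry.

Lemma size_idstr n k : (k <= n)%N -> size (idstr n k) = n.
Proof. by move=> le_kn; rewrite size_cat !size_nseq subnKC. Qed.

Lemma ones_idstr n k : ones (idstr n k) = k.
Proof. by rewrite ones_cat !ones_nseq mul1n addn0. Qed.

Local Notation mul := (mulstr rat).

(** The defect [G] vanishes for the identity string by [mulstr_idl], and [mulstr_exchange]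
    propagates this to all [c] through strips. *)
Lemma mulstr_idr n k (c r : n.-tuple bool) : ones c = k ->
  mul c (idstr n k) (bits r) = (c == r)%:R.
Proof.
move=> oc; have le_kn : (k <= n)%N by rewrite -oc -{2}(size_tuple c);
  apply: count_size.
have sz_i : size (idstr n k) == n by rewrite size_idstr.
pose G (c : seq bool) (r : n.-tuple bool) : rat :=
  mul c (Tuple sz_i) (bits r) - (c == r)%:R.
suff G0 : forall c : n.-tuple bool, ones c = k -> forall r, G c r = 0.
  by apply/eqP; rewrite -subr_eq0; apply/eqP/G0.
clear c oc r; apply: vstrip_generation => [r|c oc Gc q nz_q r].
  rewrite /G (mulstr_idl _ _ (eqP sz_i)) ?ones_idstr //.
  by rewrite (inj_eq bits_inj) eq_sym subrr.
rewrite /G; under eq_bigr => c' _ do rewrite mulrBr.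
rewrite sumrB -(mulstr_exchange nz_q).
apply/eqP; rewrite subr_eq0; apply/eqP.
transitivity (\sum_(r' : n.-tuple bool) (r' == c)%:R * vstrip q false r' r).
  apply: eq_bigr => r' _; congr (_ * _); rewrite eq_sym.
  by apply/eqP; rewrite -subr_eq0; apply/eqP/Gc.
rewrite (sum_delta_tuple (fun s => vstrip q false s r)) ?size_tuple //.
under eq_bigr => c' _ do rewrite mulrC.
by rewrite (sum_delta_tuple (fun s => vstrip q false c s)) ?size_tuple.
Qed.

(* Second-argument form of [mulstr_exchange]: it holds for the identity string
   and is preserved by strips in the first argument since strips commute. *)
Lemma mulstr_exchange_r q n k (c b r : n.-tuple bool) : q != 0 ->
  ones c = k -> ones b = k ->
  \sum_(r' : n.-tuple bool) mul c b (bits r') * vstrip q false r' r =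
  \sum_(b' : n.-tuple bool) vstrip q false b b' * mul c b' (bits r).
Proof.
move=> nz_q oc ob.
pose D (c : seq bool) (b r : n.-tuple bool) : rat :=
  \sum_(r' : n.-tuple bool) mul c b (bits r') * vstrip q false r' r -
  \sum_(b' : n.-tuple bool) vstrip q false b b' * mul c b' (bits r).
(* [vstrip_generation] allows no condition on its parameter, so the condition on [b] becomes an
   indicator factor. *)
pose G c (br : n.-tuple bool * n.-tuple bool) :=
  (ones br.1 == k)%:R * D c br.1 br.2.
suff G0 : forall c : n.-tuple bool, ones c = k -> forall br, G c br = 0.
  by have := G0 c oc (b, r); rewrite /G /= ob eqxx mul1r => /eqP;
    rewrite subr_eq0 => /eqP.
clear c oc b ob r; apply: vstrip_generation => [[b r]|c oc Gc p nz_p [b r]].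
  rewrite /G /=; case: eqP => [ob1|]; rewrite ?mul0r ?mul1r // /D.
  apply/eqP; rewrite subr_eq0; apply/eqP.
  transitivity (\sum_(r' : n.-tuple bool) (r' == b)%:R * vstrip q false r' r).
    apply: eq_bigr => r' _; rewrite (mulstr_idl _ _ (size_tuple b)) //.
    by rewrite (inj_eq bits_inj).
  rewrite (sum_delta_tuple (fun s => vstrip q false s r)) ?size_tuple //.
  transitivity (\sum_(b' : n.-tuple bool) (b' == r)%:R * vstrip q false b b').
    by rewrite (sum_delta_tuple (fun s => vstrip q false b s)) ?size_tuple.
  apply: eq_bigr => b' _.
  have [->|nz_v] := eqVneq (vstrip q false b b') 0;
    first by rewrite mul0r mulr0.
  rewrite (mulstr_idl _ _ (size_tuple b')) ?(vstrip_count nz_v) //.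
  by rewrite (inj_eq bits_inj) mulrC eq_sym.
rewrite /G /=; case: eqP => [ob|]; last by move=> _; apply: big1 => *;
  rewrite mul0r mulr0.
under eq_bigr => c' _ do rewrite mul1r /D mulrBr !big_distrr /=.
rewrite sumrB; apply/eqP; rewrite subr_eq0; apply/eqP.
have D0 (b1 r1 : n.-tuple bool) : ones b1 = k ->
    \sum_(r' : n.-tuple bool) mul c b1 (bits r') * vstrip q false r' r1 =
    \sum_(b' : n.-tuple bool) vstrip q false b1 b' * mul c b' (bits r1).
  move=> ob1; have := Gc (b1, r1).
  by rewrite /G /= ob1 eqxx mul1r => /eqP; rewrite subr_eq0 => /eqP.
(* The strip in [p] moves from the first factor to the product and is commuted past the strip in
   [q]; then [D0] moves the latter to the second factor. *)
transitivity (\sum_(r0 : n.-tuple bool) mul c b (bits r0) *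
    \sum_(r' : n.-tuple bool) vstrip p false r0 r' * vstrip q false r' r).
  rewrite exchange_big /=.
  under [RHS]eq_bigr => r0 _ do rewrite big_distrr /=.
  rewrite [RHS]exchange_big; apply: eq_bigr => r' _ /=.
  under eq_bigr => c' _ do rewrite mulrA.
  rewrite -big_distrl -(mulstr_exchange nz_p) big_distrl /=.
  by apply: eq_bigr => r0 _; rewrite mulrA.
transitivity (\sum_(r' : n.-tuple bool)
  (\sum_(r0 : n.-tuple bool) mul c b (bits r0) * vstrip q false r0 r') *
      vstrip p false r' r).
  under eq_bigr => r0 _ do rewrite vstrip2C big_distrr /=.
  rewrite exchange_big; apply: eq_bigr => r' _ /=.
  by rewrite big_distrl; apply: eq_bigr => r0 _ /=; rewrite mulrA.
under eq_bigr => r' _ do rewrite D0 // big_distrl /=.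
rewrite exchange_big [RHS]exchange_big; apply: eq_bigr => b' _ /=.
under [RHS]eq_bigr => c' _ do rewrite mulrCA.
rewrite -[RHS]big_distrr -(mulstr_exchange nz_p) big_distrr /=.
by apply: eq_bigr => r' _; rewrite mulrA.
Qed.

(** For [b] the identity string both products are known. By the two exchange lemmas, a strip on [b]
    acts on either product as the same strip on the result. *)
Lemma mulstrC n (b c : n.-tuple bool) r :
  ones b = ones c -> mul b c r = mul c b r.
Proof.
have sz_bc (b1 c1 : n.-tuple bool) : size b1 = size c1 by rewrite !size_tuple.
move=> obc; have [r10|r10] := boolP (L10 \in r).
  by rewrite /mulstr !trap_no10.
have [sz_r|nsz_r] := eqVneq (size r) n; last first.
  have m0 (b1 c1 : n.-tuple bool) : mul b1 c1 r = 0.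
    apply/eqP/negPn/negP => /trap_size; rewrite size_zip size_rev !size_map
      !size_tuple minnn.
    exact/eqP.
  by rewrite !m0.
have [{sz_r r10} s ->] : exists s : n.-tuple bool, r = bits s.
  have sz_s : size (map (pred1 L1) r) == n by rewrite size_map sz_r.
  exists (Tuple sz_s); rewrite /= -map_comp -[LHS]map_id;
    apply/eq_in_map => l l_r /=.
  by case: l l_r r10 => // ->.
have [k oc] : exists k, ones c = k by exists (ones c).
rewrite oc in obc.
pose G (b : seq bool) (cr : n.-tuple bool * n.-tuple bool) : rat :=
  (ones cr.1 == k)%:R * (mul b cr.1 (bits cr.2) - mul cr.1 b (bits cr.2)).
suff G0 : forall b : n.-tuple bool, ones b = k -> forall cr, G b cr = 0.
  by have := G0 b obc (c, s); rewrite /G /= oc eqxx mul1r => /eqP;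
    rewrite subr_eq0 => /eqP.
clear b c r obc s oc; apply: vstrip_generation => [[c s]|b ob Gb q nz_q [c s]].
  rewrite /G /=; case: eqP => [oc|]; rewrite ?mul0r ?mul1r //.
  rewrite (mulstr_idl _ _ (size_tuple c)) // (inj_eq bits_inj)
    (mulstr_idr s oc).
  by rewrite eq_sym subrr.
rewrite /G /=; case: eqP => [oc|]; last by move=> _; apply: big1 => *;
  rewrite mul0r mulr0.
under eq_bigr => b' _ do rewrite mul1r mulrBr.
rewrite sumrB -(mulstr_exchange nz_q) -(mulstr_exchange_r s nz_q oc ob) -sumrB
  big1 // => r _.
have /= := Gb (c, r); rewrite /G /= oc eqxx mul1r => /eqP;
  rewrite subr_eq0 => /eqP ->.
by rewrite subrr.
Qed.

(* Completing the trapezoid to a triangle by a corner whose other side is an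
   identity string forces the line [s]; in the triangle with the two sides
   exchanged, the other corner is a triangle with sides [b] and [c]. *)
Lemma trapC (b c s : seq bool) r : size b = size c -> ones b = ones c ->
  trap rat (zip (bits b) (rev (bits c))) (bits s) r =
  trap rat (zip (bits c) (rev (bits b))) (bits s) r.
Proof.
move=> sz_bc obc; have [i [sz_i oi mul_i]] :
  exists i, [/\ size i = size s, ones i = ones s
    & forall t, mul i s t = (t == bits s)%:R].
  exists (idstr (size s) (ones s)); rewrite size_idstr ?count_size //
    ones_idstr.
  by split=> // t; apply: mulstr_idl.
have zip_split (s1 s2 t1 t2 : seq bool) : size s1 = size t2 ->
    zip (bits (s1 ++ s2)) (rev (bits (t1 ++ t2))) =
    zip (bits s1) (rev (bits t2)) ++ zip (bits s2) (rev (bits t1)).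
  by move=> sz; rewrite !map_cat rev_cat zip_cat // size_rev !size_map.
have trapE b1 c1 : size b1 = size c1 ->
    mul (b1 ++ i) (s ++ c1) r = trap rat (zip (bits b1) (rev (bits c1)))
      (bits s) r.
  move=> sz1; rewrite /mulstr zip_split // trap_cat.
  under eq_bigr => t _ do rewrite -/(mulstr rat i s t) mul_i.
  rewrite (sum_delta_tuple (fun t => trap rat _ t r)) //.
  by rewrite size_zip size_rev !size_map sz_i minnn.
have swapE b1 c1 : size b1 = size c1 ->
    mul (s ++ b1) (c1 ++ i) r =
    \sum_(t : (size c1).-tuple label)
       mul b1 c1 t * trap rat (zip (bits s) (rev (bits i))) t r.
  move=> sz1; rewrite /mulstr zip_split // trap_cat.
  by rewrite size_zip size_rev !size_map sz1 minnn add0n.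
have mulC (b1 c1 : seq bool) r1 : size b1 = size c1 -> ones b1 = ones c1 ->
    mul b1 c1 r1 = mul c1 b1 r1.
  by move=> sz1; have := @mulstrC _ (in_tuple b1) (tcast (esym sz1)
    (in_tuple c1)) r1; rewrite val_tcast.
(* Commutativity is applied to the whole triangle, to the corner with sides [c] and [b], and to the
   whole triangle again to come back. *)
rewrite -trapE // mulC ?size_cat ?ones_cat ?sz_i ?oi ?sz_bc ?obc 1?addnC //.
rewrite swapE //.
under eq_bigr => t _ do rewrite mulC //.
rewrite sz_bc -swapE // mulC ?trapE //.
all: by rewrite ?size_cat ?ones_cat ?sz_i ?oi ?sz_bc ?obc addnC.
Qed.

(** * Labelings of the edges layer by layer *)

Section Labelings.

Implicit Types (L : edge -> label) (E : seq edge).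

Definition relabel L e a : edge -> label := fun g => if g == e then a else L g.

Fixpoint relabels L E (t : seq label) : edge -> label :=
  match E, t with
  | e :: E1, a :: t1 => relabels (relabel L e a) E1 t1
  | _, _ => L
  end.

Lemma relabels_notin L E t g : g \notin E -> relabels L E t g = L g.
Proof.
elim: E t L => [|e E IHE] [|a t] L //=; rewrite inE negb_or => /andP[ne gE].
by rewrite IHE // /relabel (negbTE ne).
Qed.

Lemma map_relabels L E t : uniq E -> size t =
  size E -> map (relabels L E t) E = t.
Proof.
elim: E t L => [|e E IHE] [|a t] L //= /andP[eE uE] [sz_t].
by rewrite relabels_notin // /relabel eqxx IHE.
Qed.

Lemma map_relabels_disjoint L E t E' : {in E', forall e, e \notin E} ->
  map (relabels L E t) E' = map L E'.
Proof. by move=> dE; apply/eq_in_map => e /dE; apply: relabels_notin. Qed.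

Fixpoint sumL E (Phi : (edge -> label) -> rat) L : rat :=
  if E is e :: E1 then \sum_a sumL E1 Phi (relabel L e a) else Phi L.

Lemma sumL_cat E1 E2 Phi L : sumL (E1 ++ E2) Phi L = sumL E1 (sumL E2 Phi) L.
Proof. by elim: E1 L => //= e E1 IHE L; apply: eq_bigr => a _. Qed.

Lemma sumL_tuple n E Phi L : size E = n ->
  sumL E Phi L = \sum_(t : n.-tuple label) Phi (relabels L E t).
Proof.
elim: E n L => [|e E IHE] n L <- /=.
  by rewrite (sum_tuple0 (fun t => Phi (relabels L [::] t))).
rewrite (sum_tupleS _ (fun t => Phi (relabels L (e :: E) t))).
by apply: eq_bigr => a _; apply: IHE.
Qed.

Lemma sumL_factor E (Psi Phi : (edge -> label) -> rat) L :
  (forall t, Psi (relabels L E t) = Psi L) ->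
  sumL E (fun L' => Psi L' * Phi L') L = Psi L * sumL E Phi L.
Proof.
move=> Psi_E; rewrite !(sumL_tuple _ _ erefl) big_distrr.
by apply: eq_bigr => t _ /=; rewrite Psi_E.
Qed.

Lemma eq_sumL E (Phi Phi' : (edge -> label) -> rat) L :
  (forall L', Phi L' = Phi' L') -> sumL E Phi L = sumL E Phi' L.
Proof. by move=> eqPhi; rewrite !(sumL_tuple _ _ erefl); apply: eq_bigr. Qed.

(** Labelings of [E] correspond to tuples of labels along [E']; off these edges both functions take
    the default [L0]. The order of [E'] is free, which permits summing layer by layer. *)
Lemma card_labelings (phi : pred (edge -> label)) E E' : uniq E' -> E' =i E ->
  #|[set f : {ffun seq_sub E -> label} | phi (labeling_fun f)]|%:R =
  sumL E' (fun L => (phi L)%:R) (fun=> L0).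
Proof.
move=> uE' eqE; rewrite (sumL_tuple _ _ erefl) -sum1_card natr_sum big_mkcond
  /=.
pose h (t : (size E').-tuple label) : {ffun seq_sub E -> label} :=
  [ffun e => relabels (fun=> L0) E' t (val e)].
have labK t : labeling_fun (h t) = relabels (fun=> L0) E' t.
  apply: functional_extensionality => g; rewrite /labeling_fun.
  case: insubP => [g' _ <-|gE]; first by rewrite ffunE.
  by rewrite relabels_notin // eqE.
rewrite (reindex h) /=.
  by apply: eq_bigr => t _; rewrite inE labK; case: (phi _).
exists (fun f : {ffun seq_sub E -> label} => map_tuple (labeling_fun f)
  (in_tuple E')) => [t _|f _].
  by apply: val_inj; rewrite /= labK map_relabels ?size_tuple.
apply/ffunP => e; rewrite ffunE /=.
have eE' : val e \in E' by rewrite eqE; apply: (valP e).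
suff relE E1 L : uniq E1 -> val e \in E1 ->
    relabels L E1 (map (labeling_fun f) E1) (val e) = f e by apply: relE.
elim: E1 L => //= e1 E1 IHE L /andP[e1E uE1];
  rewrite inE => /orP[/eqP ee1|eE1]; last exact: IHE.
rewrite relabels_notin ?ee1 // /relabel eqxx -ee1 /labeling_fun.
by rewrite valK.
Qed.

End Labelings.

(** One term of [layer] with explicit inner labels: [gs] omits the initial edge, labeled [x],
    whereas [hs] includes the final one, compared with [y]. *)
Fixpoint chain (x : label) (s : seq label) (y : label) (r gs hs :
  seq label) : bool :=
  match s, r, gs, hs with
  | [::], [:: r0], [::], [:: h] => (h == y) && allowed x r0 h
  | s0 :: s1, r0 :: r1, g :: gs1, h :: hs1 =>
      [&& allowed x r0 h, allowed s0 h g & chain g s1 y r1 gs1 hs1]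
  | _, _, _, _ => false
  end.

Lemma layer_chain m x s y r : size s = m -> size r = m.+1 ->
  layer rat x s y r =
  \sum_(gs : m.-tuple label) \sum_(hs : m.+1.-tuple label)
      (chain x s y r gs hs)%:R.
Proof.
elim: m x s r => [|m IHm] x [|s0 s] // [|r0 r] //.
  case: r => // _ _; rewrite (sum_tuple0 (fun gs => \sum_(hs : 1.-tuple label)
    (chain x [::] y [:: r0] gs hs)%:R)).
  rewrite (sum_tuple1 (fun hs => (chain x [::] y [:: r0] [::] hs)%:R)) /=.
  by rewrite -[LHS](sum_delta_r y (fun h => weight rat x r0 h));
    apply: eq_bigr => h _; rewrite -natrM mulnb andbC.
case=> sz_s [sz_r] /=.
rewrite (sum_tupleS _ (fun gs => \sum_(hs : m.+2.-tuple label)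
    (chain x (s0 :: s) y (r0 :: r) gs hs)%:R)).
under [RHS]eq_bigr => g _.
  under eq_bigr => gs _ do rewrite
    (sum_tupleS _ (fun hs => (chain x (s0 :: s) y (r0 :: r)
        (g :: gs) hs)%:R)) /=.
  rewrite exchange_big /=; over.
rewrite [RHS]exchange_big; apply: eq_bigr => h _; rewrite big_distrr.
apply: eq_bigr => g _ /=; rewrite (IHm _ _ _ sz_s sz_r) !big_distrr.
apply: eq_bigr => gs _ /=; rewrite !big_distrr; apply: eq_bigr => hs _ /=.
by rewrite -!natrM !mulnb.
Qed.

Lemma mkseq_cons (T : Type) (f : nat -> T) n :
  mkseq f n.+1 = f 0 :: mkseq (fun i => f i.+1) n.
Proof. by rewrite /mkseq /= -[1%N]addn0 iotaDl -map_comp. Qed.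

Lemma chain_mkseq m (G H R S : nat -> label) y :
  chain (G 0) (mkseq S m) y (mkseq R m.+1) (mkseq (fun i => G i.+1) m)
    (mkseq H m.+1)
  <-> [/\ H m = y, forall i, (i <= m)%N -> allowed (G i) (R i) (H i)
      & forall i, (i < m)%N -> allowed (S i) (H i) (G i.+1)].
Proof.
elim: m G H R S => [|m IHm] G H R S.
  split=> [/andP[/eqP Hy al]|[Hy al _]]; last by rewrite /= Hy eqxx -Hy al.
  by split=> // [[]].
rewrite (mkseq_cons S) (mkseq_cons R) (mkseq_cons (fun i => G i.+1))
  (mkseq_cons H) /=.
have IH := IHm (G \o succn) (H \o succn) (R \o succn) (S \o succn).
split=> [/and3P[al1 al2 /IH[Hy alU alD]]|[Hy alU alD]].
  by split=> //; case=> // i lt_i; first [exact: (alU i) | exact: (alD i)].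
rewrite (alU 0) // (alD 0) //=; apply/IH; split=> // i lt_i;
  [exact: (alU i.+1) | exact: (alD i.+1)].
Qed.

Lemma uniq_catP (T : eqType) (s1 s2 : seq T) :
  reflect [/\ uniq s1, uniq s2 & {in s1, forall e,
    e \notin s2}] (uniq (s1 ++ s2)).
Proof.
rewrite cat_uniq; apply: (iffP and3P) => -[u1 u2 u3]; split=> //.
  by move=> e e1; apply: contra u2 => e2; apply/hasP; exists e.
by apply/hasPn => e e2; apply/negP => /u3; rewrite e2.
Qed.

Section LayeredLabelings.

Variables (a : nat) (ln ge he : nat -> nat -> edge).
Implicit Types L : edge -> label.

Definition line t := mkseq (ln t) (a + t)%N.
Definition gpath t := mkseq (ge t) (a + t).+1.
Definition hpath t := mkseq (he t) (a + t).+1.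

(** The outermost line is left out: in the hexagon it is the cut, shared by both halves. *)
Fixpoint below t : seq edge :=
  if t is t1.+1 then gpath t1 ++ hpath t1 ++ line t1 ++ below t1 else [::].

Lemma mem_below b e : (e \in below b) <->
  exists2 t, (t < b)%N & exists i, [\/ (i <= a + t)%N /\ e = ge t i,
     (i <= a + t)%N /\ e = he t i | (i < a + t)%N /\ e = ln t i].
Proof.
elim: b => [|b IHb]; first by split=> // -[].
have -> : below b.+1 = gpath b ++ hpath b ++ line b ++ below b by [].
rewrite !mem_cat; split.
  case/or4P => [/mapP[i]|/mapP[i]|/mapP[i]|/IHb[t lt_t]]; last by exists t;
    first exact: ltnW.
  - by rewrite mem_iota => /andP[_ lt_i] ->; exists b => //; exists i;
    constructor 1.
  - by rewrite mem_iota => /andP[_ lt_i] ->; exists b => //; exists i;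
    constructor 2.
  - by rewrite mem_iota => /andP[_ lt_i] ->; exists b => //; exists i;
    constructor 3.
case=> t; rewrite ltnS leq_eqVlt => /orP[/eqP-> [i hi]|lt_t ex_i]; last first.
  by apply/or4P; constructor 4; apply/IHb; exists t.
apply/or4P; case: hi => -[le_i ->].
- by constructor 1; apply: map_f; rewrite mem_iota.
- by constructor 2; apply: map_f; rewrite mem_iota.
- by constructor 3; apply: map_f; rewrite mem_iota.
Qed.

Hypothesis dir_ln : forall t i, (ln t i).1 = D120.
Hypothesis dir_ge : forall t i, (ge t i).1 = D60.
Hypothesis dir_he : forall t i, (he t i).1 = D0.

Lemma uniq_below b :
  (forall t i t' i', (t <= b)%N -> (t' <= b)%N -> (i < a + t)%N -> (i' < a +
      t')%N ->
     ln t i = ln t' i' -> t = t' /\ i = i') ->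
  (forall t i t' i', (t < b)%N -> (t' < b)%N -> (i <= a + t)%N -> (i' <= a +
      t')%N ->
     ge t i = ge t' i' -> t = t' /\ i = i') ->
  (forall t i t' i', (t < b)%N -> (t' < b)%N -> (i <= a + t)%N -> (i' <= a +
      t')%N ->
     he t i = he t' i' -> t = t' /\ i = i') ->
  uniq (line b ++ below b).
Proof.
elim: b => [|b IHb] inj_ln inj_ge inj_he.
  rewrite /= cats0; apply/mkseq_uniqP => i j /= lt_i lt_j /inj_ln.
  by rewrite -!topredE /= in lt_i lt_j; case.
have line_dir t e : e \in line t -> e.1 = D120 by case/mapP => i _ ->;
  apply: dir_ln.
have g_dir t e : e \in gpath t -> e.1 = D60 by case/mapP => i _ ->;
  apply: dir_ge.
have h_dir t e : e \in hpath t -> e.1 = D0 by case/mapP => i _ ->;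
  apply: dir_he.
have IH : uniq (line b ++ below b).
  by apply: IHb => t i t' i' lt_t lt_t'; [apply: inj_ln | apply: inj_ge |
    apply: inj_he];
    exact: ltnW.
have uniq_mkseq (f : nat -> edge) m : {in gtn m &, injective f} ->
  uniq (mkseq f m) by move/mkseq_uniqP.
have -> : below b.+1 = gpath b ++ hpath b ++ line b ++ below b by [].
apply/uniq_catP; split.
- by apply: uniq_mkseq => i j lt_i lt_j /inj_ln []; rewrite // leqnn.
- apply/uniq_catP; split; last first.
  + move=> e e_g; rewrite !mem_cat 2!negb_or; apply/and3P; split.
    * by apply/negP => /h_dir; rewrite (g_dir _ _ e_g).
    * by apply/negP => /line_dir; rewrite (g_dir _ _ e_g).
    * apply/negP => /mem_below[t lt_t [i]]; case/mapP: (e_g) => j;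
      rewrite mem_iota => /andP[_ lt_j] ->.
      case=> [][lt_i]; first by case/inj_ge => //; [exact: ltnW | lia].
      by move/(congr1 fst); rewrite dir_ge dir_he.
      by move/(congr1 fst); rewrite dir_ge dir_ln.
  + apply/uniq_catP; split=> //; last first.
      move=> e e_h; rewrite mem_cat negb_or; apply/andP; split.
        by apply/negP => /line_dir; rewrite (h_dir _ _ e_h).
      apply/negP => /mem_below[t lt_t [i]]; case/mapP: (e_h) => j;
        rewrite mem_iota => /andP[_ lt_j] ->.
      case=> [][lt_i]; [|by case/inj_he => //; [exact: ltnW | lia]|].
      by move/(congr1 fst); rewrite dir_he dir_ge.
      by move/(congr1 fst); rewrite dir_he dir_ln.
    by apply: uniq_mkseq => i j lt_i lt_j /inj_he [].
  + by apply: uniq_mkseq => i j lt_i lt_j /inj_ge [].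
- move=> e e_l; rewrite !mem_cat 3!negb_or; apply/and4P; split.
  + by apply/negP => /g_dir; rewrite (line_dir _ _ e_l).
  + by apply/negP => /h_dir; rewrite (line_dir _ _ e_l).
  + apply/negP => /mapP[i]; case/mapP: (e_l) => j;
    rewrite !mem_iota => /andP[_ lt_j] -> /andP[_ lt_i].
    by case/inj_ln => //; lia.
  + apply/negP => /mem_below[t lt_t [i]]; case/mapP: (e_l) => j;
    rewrite mem_iota => /andP[_ lt_j] ->.
    case=> [][lt_i].
    by move/(congr1 fst); rewrite dir_ge dir_ln.
    by move/(congr1 fst); rewrite dir_he dir_ln.
    by case/inj_ln => //; lia.
Qed.

Variables (x y : nat -> label) (s0 : seq label).
Hypothesis sz_s0 : size s0 = a.

Definition layer_ok t L :=
  (L (ge t 0) == x t) &&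
  chain (L (ge t 0)) (map L (line t)) (y t) (map L (line t.+1))
    (map L (behead (gpath t))) (map L (hpath t)).

Fixpoint below_ok t L : bool :=
  if t is t1.+1 then layer_ok t1 L && below_ok t1 L else map L (line 0) == s0.

Fixpoint word t := if t is t1.+1 then (x t1, y t1) :: word t1 else [::].

Lemma size_word t : size (word t) = t.
Proof. by elim: t => //= t ->. Qed.

Lemma gpathE t : gpath t = ge t 0 :: behead (gpath t).
Proof. by rewrite /gpath mkseq_cons. Qed.

(** The outermost layer is summed first. Its condition does not involve the edges further in, so it
    factors out of their sum. *)
Lemma sumL_below b L : uniq (line b ++ below b) ->
  sumL (below b) (fun L' => (below_ok b L')%:R) L =
  trap rat (word b) s0 (map L (line b)).
Proof.
elim: b L => [|b IHb] L; first by rewrite /= /trap eq_sym.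
have -> : below b.+1 = gpath b ++ hpath b ++ line b ++ below b by [].
case/uniq_catP => _; rewrite sumL_cat.
case/uniq_catP => ug /uniq_catP[uh ulb dh] dg dl.
have [ul ub db] := uniq_catP _ _ ulb.
rewrite [word _]/= (@trap_cons _ (a + b)) ?size_word ?sz_s0 //.
rewrite (@sumL_tuple (a + b).+1 (gpath b)) ?size_mkseq //.
pose r := map L (line b.+1).
have sz_r : size r = (a + b).+1 by rewrite size_map size_mkseq addnS.
pose T (tg : seq label) (th tl : seq label) : rat :=
  ((head L0 tg == x b) && chain (head L0 tg) tl (y b) r (behead tg) th)%:R *
   trap rat (word b) s0 tl.
transitivity (\sum_(tg : (a + b).+1.-tuple label)
  \sum_(th : (a + b).+1.-tuple label)
   \sum_(tl : (a + b).-tuple label) T tg th tl).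
  apply: eq_bigr => tg _; rewrite sumL_cat (@sumL_tuple (a +
    b).+1 (hpath b)) ?size_mkseq //.
  apply: eq_bigr => th _; rewrite sumL_cat (@sumL_tuple (a +
    b) (line b)) ?size_mkseq //.
  apply: eq_bigr => tl _; set L3 := relabels _ _ tl.
  have L3l : map L3 (line b) = tl by rewrite map_relabels ?size_tuple
    ?size_mkseq.
  have L3h : map L3 (hpath b) = th.
    rewrite map_relabels_disjoint => [|e /dh];
      last by rewrite mem_cat => /norP[].
    by rewrite map_relabels ?size_tuple ?size_mkseq.
  have L3g : map L3 (gpath b) = tg.
    rewrite map_relabels_disjoint => [|e /dg];
      last by rewrite !mem_cat => /norP[_ /norP[]].
    rewrite map_relabels_disjoint => [|e /dg];
      last by rewrite !mem_cat => /norP[].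
    by rewrite map_relabels ?size_tuple ?size_mkseq.
  have L3r : map L3 (line b.+1) = r.
    rewrite !map_relabels_disjoint => // e /dl;
      rewrite !mem_cat => /norP[] // _ /norP[] // _.
    by move=> /norP[].
  under eq_sumL => L' do rewrite [below_ok _ _]/(layer_ok b L' && below_ok b
    L') -mulnb natrM.
  rewrite (@sumL_factor _ (fun L' => (layer_ok b L')%:R)) => [|t].
    rewrite (IHb _ ulb) L3l /T /layer_ok L3l L3r L3h.
    by rewrite -L3g gpathE.
  have Lt E : {in E, forall e, e \notin below b} ->
      map (relabels L3 (below b) t) E = map L3 E by apply:
        map_relabels_disjoint.
  rewrite /layer_ok !Lt => // [|e /dh|e /mem_behead /dg|e /dl]; last 3 first.
  - by rewrite mem_cat => /norP[].
  - by rewrite !mem_cat => /norP[_ /norP[]].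
  - by rewrite !mem_cat => /norP[_ /norP[_ /norP[]]].
  rewrite relabels_notin //; have := dg (ge b 0);
    rewrite {1}gpathE mem_head => /(_ isT).
  by rewrite !mem_cat => /norP[_ /norP[]].
(* The first 60-degree edge lies on the boundary, so its sum collapses to the label [x b]. *)
rewrite (sum_tupleS _ (fun tg => \sum_(th : (a + b).+1.-tuple label)
   \sum_(tl : (a + b).-tuple label) T tg th tl)) (bigD1 (x b)) //= [X in _ +
       X]big1; last first.
  move=> g /negbTE ng; rewrite big1 // => tg _; rewrite big1 // => th _;
    rewrite big1 // => tl _.
  by rewrite /T /= ng mul0r.
rewrite addr0 pair_big exchange_big; apply: eq_bigr => tl _ /=.
rewrite (layer_chain _ _ (size_tuple tl) sz_r) pair_big big_distrr.
by apply: eq_bigr => gh _; rewrite /T /= eqxx mulrC.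
Qed.

Lemma eq_below_ok b L L' : {in line b ++ below b, L =1 L'} ->
  below_ok b L = below_ok b L'.
Proof.
have eq_map (E E' : seq edge) : {in E', L =1 L'} -> {subset E <= E'} ->
  map L E = map L' E.
  by move=> eqL sE; apply/eq_in_map => e /sE /eqL.
elim: b => [|b IHb] eqL; first by rewrite /= (eq_map _ _ eqL) // => e e0;
  rewrite mem_cat e0.
have sub E : E \in [:: line b.+1; gpath b; hpath b; line b; below b] ->
    {subset E <= line b.+1 ++ below b.+1}.
  have -> : below b.+1 = gpath b ++ hpath b ++ line b ++ below b by [].
  by rewrite !inE => /or4P[|||/orP[]] /eqP-> e eE; rewrite !mem_cat eE ?orbT.
rewrite /= IHb; last first.
  by move=> e; rewrite mem_cat => /orP[] /sub eE; apply/eqL/eE;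
    rewrite !inE eqxx ?orbT.
congr (_ && _); rewrite /layer_ok.
have sub_g : {subset behead (gpath b) <= line b.+1 ++ below b.+1}.
  by move=> e /mem_behead; apply: sub; rewrite !inE eqxx ?orbT.
rewrite (eq_map _ _ eqL sub_g) !(eq_map _ _ eqL (sub _ _)) ?inE ?eqxx ?orbT //.
by rewrite eqL // (sub (gpath b)) ?inE ?eqxx ?orbT // gpathE mem_head.
Qed.

Lemma below_okP b L :
  reflect ((forall t, (t < b)%N -> [/\ L (ge t 0) = x t, L (he t (a +
    t)%N) = y t,
      forall i, (i <= a + t)%N -> allowed (L (ge t i)) (L (ln t.+1 i))
        (L (he t i))
      & forall i, (i < a + t)%N -> allowed (L (ln t i)) (L (he t i))
        (L (ge t i.+1))])
    /\ map L (line 0) = s0) (below_ok b L).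
Proof.
have layP t : layer_ok t L <-> [/\ L (ge t 0) = x t, L (he t (a + t)%N) = y t,
      forall i, (i <= a + t)%N -> allowed (L (ge t i)) (L (ln t.+1 i))
        (L (he t i))
      & forall i, (i < a + t)%N -> allowed (L (ln t i)) (L (he t i))
        (L (ge t i.+1))].
  rewrite /layer_ok /gpath mkseq_cons /line addnS /hpath -!map_comp.
  have := @chain_mkseq (a + t) (L \o ge t) (L \o he t) (L \o ln t.+1)
    (L \o ln t) (y t).
  move=> chP; split=> [/andP[/eqP gx /chP[]] //|[gx hy up dn]].
  by apply/andP; split; [apply/eqP | apply/chP].
elim: b => [|b IHb] /=; first by apply: (iffP eqP) => [|[]].
apply: (iffP andP) => [[/layP ok_b /IHb[ok <-]]|[ok ok0]].
  by split=> // t; rewrite ltnS leq_eqVlt => /orP[/eqP->|/ok].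
by split; [apply/layP/ok | apply/IHb; split=> // t lt_t; apply/ok/ltnW].
Qed.

End LayeredLabelings.

(** * The two halves of the hexagon *)

Lemma allowedC x y z : allowed x y z = allowed y z x.
Proof. by case: x; case: y; case: z. Qed.

Lemma wordE x y t : word x y t = rev (mkseq (fun i => (x i, y i)) t).
Proof. by elim: t => //= t ->; rewrite mkseqS rev_rcons. Qed.

(** Clockwise, the NW side starts at the innermost layer and the South side at the outermost, so
    just one of them is reversed. *)
Lemma word_zip b (s u : seq label) : size s = b -> size u = b ->
  word (nth L0 s) (fun t => nth L0 u (b - t.+1)) b = zip (rev s) u.
Proof.
move=> sz_s sz_u; rewrite wordE -[u in RHS]revK -rev_zip ?size_rev ?sz_s ?sz_u
  //.
congr rev; apply: (@eq_from_nth _ (L0, L0)) => [|i]; rewrite size_mkseq.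
  by rewrite size_zip size_rev sz_s sz_u minnn.
by move=> lt_i; rewrite nth_mkseq // nth_zip ?size_rev ?sz_s ?sz_u //
  nth_rev sz_u.
Qed.

Lemma side_labeledP L f m w : size w = m ->
  side_labeled L (mkseq f m) w <->
  forall i, (i < m)%N -> L (f i) = nth L0 (bits w) i.
Proof.
move=> sz_w; split=> [/eqP eq_w i lt_i|Lf].
  by rewrite -eq_w (nth_map (f 0)) ?size_mkseq // nth_mkseq.
apply/eqP/(@eq_from_nth _ L0); rewrite !size_map size_iota // => i lt_i.
by rewrite (nth_map (f 0)) ?size_mkseq // nth_mkseq // Lf.
Qed.

Lemma triangles_allowedP L a b c d :
  triangles_allowed L a b c d <->
  (forall x y, in_hexagon a b c d (x, y) -> in_hexagon a b c d (x.+1, y) ->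
     in_hexagon a b c d (x, y.+1) ->
     allowed (L (D60, (x, y))) (L (D120, (x, y))) (L (D0, (x, y)))) /\
  (forall x y, in_hexagon a b c d (x.+1, y) -> in_hexagon a b c d (x, y.+1) ->
     in_hexagon a b c d (x.+1, y.+1) ->
     allowed (L (D120, (x, y))) (L (D0, (x, y.+1))) (L (D60, (x.+1, y)))).
Proof.
split=> [/forallP tri|[up dn]]; last first.
  apply/forallP => x; apply/forallP => y; apply/andP; split;
    apply/implyP => /and3P[h1 h2 h3].
    exact: up.
  exact: dn.
have tri_xy x y : in_hexagon a b c d (x.+1, y) ->
  in_hexagon a b c d (x, y.+1) ->
    exists (x' : 'I_(c + d)) (y' : 'I_(a + b)), x = x' :> nat /\ y = y' :> nat.
  move=> /and3P[/= lt_x _ _] /and3P[/= _ lt_y _].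
  by exists (Ordinal lt_x), (Ordinal lt_y).
split=> x y h1 h2 h3.
  have [x' [y' [ex ey]]] := tri_xy x y h2 h3; subst.
  by have /forallP/(_ y')/andP[/implyP up _] := tri x'; apply: up; apply/and3P.
have [x' [y' [ex ey]]] := tri_xy x y h1 h2; subst.
by have /forallP/(_ y')/andP[_ /implyP dn] := tri x'; apply: dn; apply/and3P.
Qed.

Section HexagonHalves.

Variables (a b c d : nat).
Hypothesis hex_ab : (a + b = d + c)%N.

(** Line [t] joins the points with coordinate sum [a + t]; the SW side is [t = 0] and the cut is
    [t = b]. *)
Definition ln1 t i : edge := (D120, (i, a + t - i.+1)%N).
Definition ge1 t i : edge := (D60, (i, a + t - i)%N).
Definition he1 t i : edge := (D0, (i, a + t - i)%N).

(* The second half is the image of a trapezoid under the half turn of the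
   hexagon. *)
Definition ln2 t i : edge := (D120, (c + d - i.+1, c - t + i)%N).
Definition ge2 t i : edge := (D60, (c + d - i, c - t.+1 + i)%N).
Definition he2 t i : edge := (D0, (c + d - i.+1, c - t + i)%N).

Definition hexagon_layers : seq edge :=
  line a ln1 b ++ below a ln1 ge1 he1 b ++ below d ln2 ge2 he2 c.

Lemma line2_rev : line d ln2 c = rev (line a ln1 b).
Proof.
apply: (@eq_from_nth _ (D0, (0, 0)%N)) => [|i]; rewrite ?size_rev !size_mkseq;
  first by lia.
move=> lt_i; rewrite nth_mkseq // nth_rev ?size_mkseq ?nth_mkseq; try lia.
by rewrite /ln1 /ln2; congr (_, (_, _)); lia.
Qed.

Lemma uniq_half1 : uniq (line a ln1 b ++ below a ln1 ge1 he1 b).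
Proof.
by apply: uniq_below => // t i t' i' ? ? ? ? []; split; lia.
Qed.

Lemma uniq_half2 : uniq (line d ln2 c ++ below d ln2 ge2 he2 c).
Proof.
by apply: uniq_below => // t i t' i' ? ? ? ? []; split; lia.
Qed.

Lemma half2_notin_half1 e : e \in below d ln2 ge2 he2 c ->
  e \notin line a ln1 b ++ below a ln1 ge1 he1 b.
Proof.
case/mem_below => t lt_t [i e_i]; apply/negP;
  rewrite mem_cat => /orP[/mapP[j]|].
  rewrite mem_iota => /andP[_ lt_j] e_j.
  by case: e_i => [][le_i e_i]; move: e_j; rewrite e_i // => -[]; lia.
case/mem_below => t' lt_t' [i' e_i'].
by case: e_i => [][le_i e_i]; case: e_i' => [][le_i']; rewrite e_i // => -[];
  lia.
Qed.

Lemma uniq_hexagon_layers : uniq hexagon_layers.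
Proof.
rewrite /hexagon_layers catA; apply/uniq_catP; split; first exact: uniq_half1.
  by have /uniq_catP[] := uniq_half2.
by move=> e e1; apply/negP => /half2_notin_half1; rewrite e1.
Qed.

Lemma mem_hexagon_layers : hexagon_layers =i hexagon_edges a b c d.
Proof.
move=> [k [x y]]; rewrite /hexagon_edges mem_filter.
have -> : ((k, (x, y)) \in [seq (k, p) | k <- [:: D0; D60; D120],
      p <- [seq (x, y) | x <- iota 0 (c + d).+1, y <- iota 0 (a + b).+1]]) =
    (x <= c + d)%N && (y <= a + b)%N.
  apply/allpairsP/andP => [[[k' p'] [_ /allpairsP[[x' y'] []]]]|[le_x le_y]].
    by rewrite !mem_iota => /= le_x le_y -> [_ -> ->]; lia.
  exists (k, (x, y)); split=> //; first by case: k.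
  by apply/allpairsP; exists (x, y); split=> //; rewrite mem_iota /=; lia.
apply/idP/idP.
  rewrite /hexagon_layers !mem_cat => /or3P[/mapP[i]|/mem_below[t lt_t
    [i]]|/mem_below[t lt_t [i]]].
  - by rewrite mem_iota => /andP[_ lt_i] [-> -> ->] /=; rewrite /in_hexagon /=;
    lia.
  - by case=> -[le_i [-> -> ->]] /=; rewrite /in_hexagon /=; lia.
  - by case=> -[le_i [-> -> ->]] /=; rewrite /in_hexagon /=; lia.
rewrite /hexagon_layers !mem_cat => /andP[in_hex le_xy].
apply/or3P; case: k in_hex => /=; rewrite /in_hexagon /= => in_hex.
(* Edges of directions 0 and 60 join coordinate sums [x + y] and [(x + y).+1], which determines
   their half and layer; a 120-degree edge has constant sum [(x + y).+1] and may lie on the cut. *)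
- have [lt_n|le_n] := ltnP (x + y) (a + b).
    constructor 2; apply/mem_below; exists (x + y - a)%N; first by lia.
    by exists x; constructor 2; split; [lia | rewrite /he1; congr (_, (_, _));
      lia].
  constructor 3; apply/mem_below; exists (c + d - x.+1 + c - y)%N; first by lia.
  by exists (c + d - x.+1)%N; constructor 2; split; [lia | rewrite /he2;
    congr (_, (_, _)); lia].
- have [lt_n|le_n] := ltnP (x + y) (a + b).
    constructor 2; apply/mem_below; exists (x + y - a)%N; first by lia.
    by exists x; constructor 1; split; [lia | rewrite /ge1; congr (_, (_, _));
      lia].
  constructor 3; apply/mem_below; exists (c + d - x + c - y.+1)%N; first by lia.
  by exists (c + d - x)%N; constructor 1; split; [lia | rewrite /ge2;
    congr (_, (_, _)); lia].
- have [eq_n|ne_n] := eqVneq (x + y).+1 (a + b)%N.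
    constructor 1; apply/mapP; exists x; first by rewrite mem_iota; lia.
    by rewrite /ln1; congr (_, (_, _)); lia.
  have [lt_n|le_n] := ltnP (x + y).+1 (a + b).
    constructor 2; apply/mem_below; exists (x + y.+1 - a)%N; first by lia.
    by exists x; constructor 3; split; [lia | rewrite /ln1; congr (_, (_, _));
      lia].
  constructor 3; apply/mem_below; exists (c + d - x.+1 + c - y)%N; first by lia.
  by exists (c + d - x.+1)%N; constructor 3; split; [lia | rewrite /ln2;
    congr (_, (_, _)); lia].
Qed.

Lemma side_SW_rev : side_SW a = rev (line a ln1 0).
Proof.
apply: (@eq_from_nth _ (D0, (0, 0)%N)) => [|i]; rewrite ?size_rev !size_mkseq;
  first by lia.
move=> lt_i; rewrite nth_mkseq // nth_rev ?size_mkseq ?nth_mkseq; try lia.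
by rewrite /ln1; congr (_, (_, _)); lia.
Qed.

Lemma side_NE_rev : side_NE a b c d = rev (line d ln2 0).
Proof.
apply: (@eq_from_nth _ (D0, (0, 0)%N)) => [|i]; rewrite ?size_rev !size_mkseq;
  first by lia.
move=> lt_i; rewrite nth_mkseq // nth_rev ?size_mkseq ?nth_mkseq; try lia.
by rewrite /ln2; congr (_, (_, _)); lia.
Qed.

Lemma is_puzzle_halves L alpha beta gamma delta epsilon zeta :
  size alpha = a -> size beta = b -> size gamma = c ->
  size delta = d -> size epsilon = c -> size zeta = b ->
  is_puzzle L alpha beta gamma delta epsilon zeta =
  below_ok a ln1 ge1 he1 (nth L0 (bits beta))
    (fun t => nth L0 (bits zeta) (b - t.+1)) (rev (bits alpha)) b L &&
  below_ok d ln2 ge2 he2 (nth L0 (bits epsilon))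
    (fun t => nth L0 (bits gamma) (c - t.+1)) (rev (bits delta)) c L.
Proof.
move=> sa sb sc sd se sz.
have rev_side l (w : seq bool) : side_labeled L (rev l) w =
  (map L l == rev (bits w)).
  by rewrite /side_labeled map_rev -(inj_eq (can_inj revK)) revK.
rewrite /is_puzzle sa sb sc sd se sz side_SW_rev side_NE_rev !rev_side.
apply/idP/idP.
  case/and5P => /eqP lab_a /(side_labeledP _ _ sb)
    lab_b /(side_labeledP _ _ sc) lab_c /eqP lab_d.
  case/and3P => /(side_labeledP _ _ se) lab_e /(side_labeledP _ _ sz) lab_z.
  case/triangles_allowedP => up dn; apply/andP; split; apply/below_okP;
    split=> // t lt_t.
    split.
    - by rewrite -lab_b // /ge1 subn0.
    - rewrite -lab_z; last by lia.
      by rewrite /he1; congr (L (_, (_, _))); lia.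
    - move=> i le_i; have := up i (a + t - i)%N.
      rewrite (_ : ln1 t.+1 i = (D120, (i, a + t - i)%N));
        last by congr (_, (_, _)); lia.
      by apply; rewrite /in_hexagon /=; lia.
    - move=> i lt_i; have := dn i (a + t - i.+1)%N.
      rewrite (_ : he1 t i = (D0, (i, (a + t - i.+1).+1)));
        last by congr (_, (_, _)); lia.
      by apply; rewrite /in_hexagon /=; lia.
  split.
  - by rewrite -lab_e // /ge2; congr (L (_, (_, _))); lia.
  - rewrite -lab_c; last by lia.
    by rewrite /he2; congr (L (_, (_, _))); lia.
  (* The half turn exchanges upward and downward triangles; [allowedC] realigns the starting
     side. *)
  - move=> i le_i; have := dn (c + d - i.+1)%N (c - t.+1 + i)%N.
    rewrite (_ : ge2 t i = (D60, ((c + d - i.+1).+1, c - t.+1 + i)%N));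
      last by congr (_, (_, _)); lia.
    rewrite (_ : he2 t i = (D0, (c + d - i.+1, (c - t.+1 + i).+1)%N));
      last by congr (_, (_, _)); lia.
    by rewrite 2!allowedC; apply; rewrite /in_hexagon /=; lia.
  - move=> i lt_i; have := up (c + d - i.+1)%N (c - t + i)%N.
    rewrite (_ : ge2 t i.+1 = (D60, (c + d - i.+1, c - t + i)%N));
      last by congr (_, (_, _)); lia.
    by rewrite allowedC; apply; rewrite /in_hexagon /=; lia.
case/andP => /below_okP[half1 lab_a] /below_okP[half2 lab_d].
apply/and5P; split; [exact/eqP | apply/(side_labeledP _ _ sb) => t lt_t
  | apply/(side_labeledP _ _ sc) => t lt_t | exact/eqP |].
- by have [<- _ _ _] := half1 t lt_t; rewrite /ge1 subn0.
- have [|_ + _ _] := half2 (c - t.+1)%N; first by lia.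
  rewrite (_ : c - (c - t.+1).+1 = t)%N; last by lia.
  by move <-; rewrite /he2; congr (L (_, (_, _))); lia.
apply/and3P; split; [apply/(side_labeledP _ _ se) => t lt_t
  | apply/(side_labeledP _ _ sz) => t lt_t |].
- by have [<- _ _ _] := half2 t lt_t; rewrite /ge2; congr (L (_, (_, _))); lia.
- have [|_ + _ _] := half1 (b - t.+1)%N; first by lia.
  rewrite (_ : b - (b - t.+1).+1 = t)%N; last by lia.
  by move <-; rewrite /he1; congr (L (_, (_, _))); lia.
apply/triangles_allowedP; split=> x y; rewrite /in_hexagon /= => h1 h2 h3.
- have [lt_n|le_n] := ltnP (x + y) (a + b).
    have [|_ _ up _] := half1 (x + y - a)%N; first by lia.
    have := up x; rewrite /ge1 /he1 /ln1 (_ : a + (x + y - a) - x = y)%N;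
      last by lia.
    rewrite (_ : a + (x + y - a).+1 - x.+1 = y)%N; last by lia.
    by apply; lia.
  have [|_ _ _ dn] := half2 (c + d - x.+1 + c - y)%N; first by lia.
  have := dn (c + d - x.+1)%N; rewrite /ge2 /he2 /ln2 2!allowedC.
  rewrite (_ : c + d - (c + d - x.+1).+1 = x)%N; last by lia.
  rewrite (_ : c - (c + d - x.+1 + c - y) + (c + d - x.+1) = y)%N; last by lia.
  rewrite (_ : c - (c + d - x.+1 + c - y).+1 + (c + d - x.+1).+1 = y)%N;
    last by lia.
  by apply; lia.
- have [lt_n|le_n] := ltnP (x + y).+1 (a + b).
    have [|_ _ _ dn] := half1 (x + y.+1 - a)%N; first by lia.
    have := dn x; rewrite /ge1 /he1 /ln1 (_ : a + (x + y.+1 - a) - x = y.+1)%N;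
      last by lia.
    rewrite (_ : a + (x + y.+1 - a) - x.+1 = y)%N; last by lia.
    by apply; lia.
  have [|_ _ up _] := half2 (c + d - x.+1 + c - y.+1)%N; first by lia.
  have := up (c + d - x.+1)%N; rewrite /ge2 /he2 /ln2 allowedC.
  rewrite (_ : c + d - (c + d - x.+1).+1 = x)%N; last by lia.
  rewrite (_ : c - (c + d - x.+1 + c - y.+1).+1 + (c + d - x.+1) = y)%N;
    last by lia.
  rewrite (_ : c - (c + d - x.+1 + c - y.+1) + (c + d - x.+1) = y.+1)%N;
    last by lia.
  rewrite (_ : c + d - (c + d - x.+1) = x.+1)%N; last by lia.
  by apply; lia.
Qed.

End HexagonHalves.

(** Once the cut is labeled by [m], the halves share no free edge and the count factors. The half
    turn reverses the cut and puts [epsilon], [gamma] in the roles of the NW and South sides. *)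
Lemma Hex_trap alpha beta gamma delta epsilon zeta :
  size beta = size zeta -> size gamma = size epsilon ->
  (size alpha + size beta = size delta + size gamma)%N ->
  (Hex alpha beta gamma delta epsilon zeta)%:R =
  \sum_(m : (size alpha + size beta).-tuple label)
    trap rat (zip (bits (rev beta)) (bits zeta)) (bits (rev alpha)) m *
    trap rat (zip (bits (rev epsilon)) (bits gamma)) (bits (rev delta)) (rev m).
Proof.
move=> sz_bz sz_ce hex_ab.
pose a := size alpha; pose b := size beta; pose c := size gamma;
  pose d := size delta.
have hex_ad : (a + b = d + c)%N := hex_ab.
pose ok1 := below_ok a (ln1 a) (ge1 a) (he1 a) (nth L0 (bits beta))
    (fun t => nth L0 (bits zeta) (b - t.+1)) (rev (bits alpha)) b.
pose ok2 := below_ok d (ln2 c d) (ge2 c d) (he2 c d) (nth L0 (bits epsilon))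
    (fun t => nth L0 (bits gamma) (c - t.+1)) (rev (bits delta)) c.
rewrite /Hex -/a -/b -/c -/d.
rewrite (card_labelings (fun L => is_puzzle L alpha beta gamma delta epsilon
  zeta) (uniq_hexagon_layers hex_ad) (mem_hexagon_layers hex_ad)).
rewrite (eq_sumL _ _ (Phi' := fun L => (ok1 L)%:R * (ok2 L)%:R)); last first.
  by move=> L; rewrite -natrM mulnb; congr (nat_of_bool _)%:R;
    apply: is_puzzle_halves.
have sum1 L : sumL (below a (ln1 a) (ge1 a) (he1 a) b)
  (fun L' => (ok1 L')%:R) L =
    trap rat (zip (bits (rev beta)) (bits zeta)) (bits (rev alpha))
      (map L (line a (ln1 a) b)).
  rewrite sumL_below ?size_rev ?size_map //; last exact: uniq_half1.
  by rewrite word_zip ?size_map ?map_rev.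
have sum2 L : sumL (below d (ln2 c d) (ge2 c d) (he2 c d) c)
  (fun L' => (ok2 L')%:R) L =
    trap rat (zip (bits (rev epsilon)) (bits gamma)) (bits (rev delta))
      (rev (map L (line a (ln1 a) b))).
  rewrite sumL_below ?size_rev ?size_map //; last exact: uniq_half2.
  by rewrite word_zip ?size_map ?map_rev // (line2_rev hex_ad) map_rev.
pose half1 := line a (ln1 a) b ++ below a (ln1 a) (ge1 a) (he1 a) b.
have ok1_local L E t : {in E, forall e, e \notin half1} ->
  ok1 (relabels L E t) = ok1 L.
  by move=> dE; apply: eq_below_ok => e e1; rewrite relabels_notin //;
    apply/negP => /dE; rewrite e1.
rewrite /hexagon_layers sumL_cat (@sumL_tuple (a + b)) ?size_mkseq //.
apply: eq_bigr => m _; set L := relabels _ _ _.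
have Lm : map L (line a (ln1 a) b) = m.
  rewrite map_relabels ?size_tuple ?size_mkseq //.
  by have /uniq_catP[] := uniq_half1 hex_ad.
rewrite sumL_cat.
(* The second half is summed first; [ok1] is constant on its free edges. *)
transitivity (sumL (below a (ln1 a) (ge1 a) (he1 a) b)
   (fun L' => (trap rat (zip (bits (rev epsilon)) (bits gamma))
       (bits (rev delta))
      (rev (map L' (line a (ln1 a) b)))) * (ok1 L')%:R) L).
  apply: eq_sumL => L'; rewrite -sum2 [RHS]mulrC.
  rewrite (@sumL_factor _ (fun L => (ok1 L)%:R)) // => t.
  by rewrite ok1_local // => e; apply: (half2_notin_half1 hex_ad).
rewrite (@sumL_factor _ (fun L => trap rat _ _ (rev (map L _)))) => [|t].
  by rewrite sum1 Lm mulrC.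
by rewrite map_relabels_disjoint //; have /uniq_catP[] := uniq_half1 hex_ad.
Qed.

Lemma Hex_commute alpha beta gamma delta epsilon zeta :
  size beta = size zeta -> ones beta = ones zeta -> size gamma = size epsilon ->
  (size alpha + size beta = size delta + size gamma)%N ->
  Hex alpha beta gamma delta epsilon zeta =
    Hex alpha zeta gamma delta epsilon beta.
Proof.
move=> sz_bz ones_bz sz_ce hex_ab; apply/eqP; rewrite -(eqr_nat rat); apply/eqP.
rewrite !Hex_trap // -?sz_bz //; apply: eq_bigr => m _; congr (_ * _).
have ones_rev s : ones (rev s) = ones s by rewrite /ones count_rev.
(* In [Hex_trap] the strings are read against the convention of [trapC], hence the reversals. *)
by have := @trapC (rev beta) (rev zeta) (rev alpha) m;
  rewrite -!map_rev !revK !size_rev !ones_rev; apply.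
Qed.

Lemma Hex_commute_r alpha beta gamma delta epsilon zeta :
  size beta = size zeta -> ones beta = ones zeta ->
  size gamma = size epsilon -> ones gamma = ones epsilon ->
  (size alpha + size beta = size delta + size gamma)%N ->
  Hex alpha beta gamma delta epsilon zeta =
    Hex alpha beta epsilon delta gamma zeta.
Proof.
move=> sz_bz ones_bz sz_ce ones_ce hex_ab; apply/eqP; rewrite -(eqr_nat rat);
  apply/eqP.
rewrite !Hex_trap // -?sz_ce //; apply: eq_bigr => m _; congr (_ * _).
have ones_rev s : ones (rev s) = ones s by rewrite /ones count_rev.
by have := @trapC (rev epsilon) (rev gamma) (rev delta) (rev m);
  rewrite -!map_rev !revK !size_rev !ones_rev; apply.
Qed.

Local Close Scope ring_scope.

Theorem theorem8
  (a0 a1 b0 b1 c0 c1 d0 d1 e0 e1 z0 z1 : nat)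
  (hbc0 : b0 + c0 = e0 + z0) (hbc1 : b1 + c1 = e1 + z1)
  (hab0 : a0 + b0 = d0 + e0) (hab1 : a1 + b1 = d1 + e1)
  (hcd0 : c0 + d0 = z0 + a0) (hcd1 : c1 + d1 = z1 + a1)
  (alpha beta gamma delta epsilon zeta : seq bool)
  (halpha : alpha \in strings (a0 + a1) a1)
  (hbeta : beta \in strings (b0 + b1) b1)
  (hgamma : gamma \in strings (c0 + c1) c1)
  (hdelta : delta \in strings (d0 + d1) d1)
  (hepsilon : epsilon \in strings (e0 + e1) e1)
  (hzeta : zeta \in strings (z0 + z1) z1)
  (hsort : sort01 beta = sort01 zeta) :
  sort01 gamma = sort01 epsilon /\
  [/\ Hex alpha beta gamma delta epsilon zeta
        = Hex alpha zeta gamma delta epsilon beta,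
      Hex alpha zeta gamma delta epsilon beta
        = Hex alpha beta epsilon delta gamma zeta
    & Hex alpha beta epsilon delta gamma zeta
        = Hex alpha zeta epsilon delta gamma beta].
Proof.
have [[sa oa] [sb ob] [sc oc]] : [/\ size alpha = a0 + a1 /\ ones alpha = a1,
    size beta = b0 + b1 /\ ones beta = b1 & size gamma = c0 +
      c1 /\ ones gamma = c1].
  by move: halpha hbeta hgamma => /andP[/eqP ? /eqP ?] /andP[/eqP ? /eqP ?]
    /andP[/eqP ? /eqP ?].
have [[sd od] [se oe] [sz oz]] : [/\ size delta = d0 + d1 /\ ones delta = d1,
    size epsilon = e0 + e1 /\ ones epsilon = e1 & size zeta = z0 +
      z1 /\ ones zeta = z1].
  by move: hdelta hepsilon hzeta => /andP[/eqP ? /eqP ?] /andP[/eqP ? /eqP ?]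
    /andP[/eqP ? /eqP ?].
have size_sort01 s : size (sort01 s) = size s.
  by rewrite size_cat !size_nseq subnK ?count_size.
have ones_sort01 s : ones (sort01 s) = ones s.
  by rewrite ones_cat !ones_nseq mul0n mul1n.
have sz_bz : size beta = size zeta by rewrite -size_sort01 hsort size_sort01.
have ones_bz : ones beta = ones zeta by rewrite -ones_sort01 hsort ones_sort01.
(* Cancelling [beta] against [zeta] in [b_i + c_i = e_i + z_i] leaves equal contents for [gamma] and
   [epsilon]. *)
have sz_ce : size gamma = size epsilon by lia.
have ones_ce : ones gamma = ones epsilon by lia.
have hex_ab : size alpha + size beta = size delta + size gamma by lia.
split.
  by rewrite /sort01 -/(ones gamma) -/(ones epsilon) sz_ce ones_ce.
split.
- exact: Hex_commute.
- by rewrite -Hex_commute // Hex_commute_r.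
- by apply: Hex_commute => //; rewrite -sz_ce.
Qed.
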